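(* Let $p(t)=\sum_{j=0}^da_jt^j$ be a univariate Gårding polynomial, where $1\le d\le n$ and $a_d>0$, and set $$f(x)=\sum_{j=0}^d\frac{a_j}{\binom nj}\sigma_j(x)\quad(x\in\mathbb R^n),\qquad G_p(A)=f(\lambda_\rho(A))\quad(A\in Q(V)).$$ Define $$\mathcal C_f^{(1)}:=\bigcap_{i=1}^n\mathcal C_{\partial_if},\qquad \Gamma_f:=\begin{cases}\mathcal C_f^{(1)},&d\ge2,\\ \mathcal C_f,&d=1,\end{cases}\qquad \mathcal A_p:=\{A\in Q(V):\lambda_\rho(A)\in\Gamma_f\}.$$ Then $(G_p,\mathcal A_p)$ is admissible and satisfies QSH. Whenever $\lambda_\rho(A)\in\mathcal C_f^{(1)}$ and $P\ge0$, $$G_p(A+P)-G_p(A)\ge\frac{a_d}{\binom nd}\sigma_d(P)\ge a_d\det_\rho(P)^{d/n}.$$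
   Context: $V$ is a complex vector space of dimension $n$ with a fixed positive definite Hermitian form $\rho$; $Q(V)$ is the real vector space of Hermitian forms, $Q(V)^+$, $Q(V)^{++}$ the semipositive and positive definite ones. $\lambda_\rho(A)\in\mathbb R^n$ is the vector of eigenvalues of $A$ relative to $\rho$ (order irrelevant, by symmetry), $\sigma_j$ is the $j$-th elementary symmetric polynomial ($\sigma_0=1$), $\sigma_d(P)=\sigma_d(\lambda_\rho(P))$, $\det_\rho P=\sigma_n(P)$, $\operatorname{tr}_\rho A=\sigma_1(A)$. Gårding polynomials on $\mathbb R^m$: a set $\mathcal U\subseteq\mathbb R^m$ passes the ray test if $\mathcal U+\mathcal K\subseteq\mathcal U$, where $\mathcal K$ is the closed nonnegative orthant. For a nonzero polynomial $g$, $\{g>0\}$ has at most one connected component passing the ray test; if it exists it is denoted $\mathcal C_g$ (for a positive constant, $\mathcal C_g=\mathbb R^m$). A nonzero $g$ is Gårding (recursively on degree) if $\mathcal C_g$ exists and, whenever $\deg g\ge1$, for every $P\in\mathcal K$ with $\partial_Pg\not\equiv0$ the directional derivative $\partial_Pg$ is Gårding and $\mathcal C_g\subseteq\mathcal C_{\partial_Pg}$. The polarization $f$ of a univariate Gårding polynomial is known to be Gårding. Admissible (for the fixed fiber $Q(V)$) means: $\mathcal A_p$ is open; (A1) $\mathcal A_p\ne\varnothing$ and $\mathcal A_p+Q(V)^+\subset\mathcal A_p$; (A2) $G_p(A+P)>G_p(A)$ for $A\in\mathcal A_p$, $P\in Q(V)^{++}$; (A3) for every $A_0\in\partial\mathcal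 A_p$, $\limsup_{A\in\mathcal A_p,\,A\to A_0}G_p(A)\le0$. QSH: there is a constant $b\ge0$ with $\operatorname{tr}_\rho A\ge-b$ for every $A\in\mathcal A_p$. *)

(* Defs.v *)
From HB Require Import structures.
From mathcomp Require Import all_boot all_order all_algebra.
From mathcomp Require Import sesquilinear.
From mathcomp Require Import complex.
(* The notations of mpoly clash with those of mathcomp-analysis. *)
From mathcomp Require Import -(notations) mpoly.
From mathcomp Require Import all_classical all_reals all_analysis.

Set Implicit Arguments.
Unset Strict Implicit.
Unset Printing Implicit Defensive.

Import Order.TTheory GRing.Theory Num.Theory.
Import numFieldNormedType.Exports.

Local Open Scope classical_set_scope.
Local Open Scope ring_scope.

Section Garding.
Context {R : realType}.

Definition mpeval m (g : mpoly m R) (x : 'rV[R]_m) : R := meval (x 0) g.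

Definition dirderiv m (P : 'rV[R]_m) (g : mpoly m R) : mpoly m R :=
  \sum_(i < m) P 0 i *: mderiv i g.

Definition orthant m : set 'rV[R]_m := [set P | forall i, 0 <= P 0 i].

Definition ray_test m (U : set 'rV[R]_m) : Prop :=
  forall x P, U x -> orthant P -> U (x + P).

Definition pos_set m (g : mpoly m R) : set 'rV[R]_m := [set x | 0 < mpeval g x].

Definition garding_component m (g : mpoly m R) (U : set 'rV[R]_m) : Prop :=
  (exists2 x, pos_set g x & U = connected_component (pos_set g) x) /\
  ray_test U.

Lemma garding_component_uniq m (g : mpoly m R) U U' :
  garding_component g U -> garding_component g U' -> U = U'.
Proof.
move=> [[x gx ->] rx] [[y gy ->] ry].
pose z : 'rV[R]_m := \row_i Num.max (x 0 i) (y 0 i).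
have zx : connected_component (pos_set g) x z.
  have -> : z = x + (z - x) by rewrite addrC subrK.
  apply: rx; first exact: connected_component_refl.
  by move=> i; rewrite !mxE subr_ge0 le_max lexx.
have zy : connected_component (pos_set g) y z.
  have -> : z = y + (z - y) by rewrite addrC subrK.
  apply: ry; first exact: connected_component_refl.
  by move=> i; rewrite !mxE subr_ge0 le_max lexx orbT.
by rewrite (same_connected_component zx) (same_connected_component zy).
Qed.

(* The component C_g: by garding_component_uniq the union has at most one
   member; it is empty when C_g does not exist. *)
Definition garding_cone m (g : mpoly m R) : set 'rV[R]_m :=
  \bigcup_(U in garding_component g) U.

(* msize is the total degree plus one, so 1 < msize g means deg g >= 1. The
   recursion on the degree is rendered by an inductive predicate. *)
Inductive garding m (g : mpoly m R) : Prop :=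
  Garding of g != 0
    & (exists U, garding_component g U)
    & ((1 < msize g)%N ->
       forall P, orthant P -> dirderiv P g != 0 -> garding (dirderiv P g))
    & ((1 < msize g)%N ->
       forall P, orthant P -> dirderiv P g != 0 ->
         garding_cone g `<=` garding_cone (dirderiv P g)).

Definition mpoly_of_poly (p : {poly R}) : mpoly 1 R :=
  \sum_(j < size p) p`_j *: mpolyX R (mnm1 ord0) ^+ j.

Definition polarization n (p : {poly R}) : mpoly n R :=
  \sum_(j < size p) (p`_j / 'C(n, j)%:R) *: mesym n R j.

Definition garding_cone1 n (f : mpoly n R) : set 'rV[R]_n :=
  \bigcap_(i in [set: 'I_n]) garding_cone (mderiv i f).

Definition Gamma n (d : nat) (f : mpoly n R) : set 'rV[R]_n :=
  if (2 <= d)%N then garding_cone1 f else garding_cone f.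

End Garding.

Section HermitianForms.
Context {R : realType} (V : vectType R[i]).
Local Notation C := R[i].
Local Notation n := (\dim {:V}).

Definition is_hermform : {pred V -> V -> C} :=
  [pred A : V -> V -> C |
    `[< exists B : {hermitian_sym V for Num.conj}, A = B :> (V -> V -> C) >]].

Lemma is_hermformP (A : V -> V -> C) :
  reflect ((forall v, scalar (A^~ v)) /\ (forall u v, A u v = (A v u)^*))
          (A \in is_hermform).
Proof.
rewrite unfold_in /=; apply: (iffP (asboolP _)) => [[B ->]|[linA hermA]].
  split=> [v|u v]; first by move=> a x y; rewrite linearPl.
  by rewrite hermC expr0 mul1r.
have bilA : bilinear_for ( *%R ) (Num.conj \; *%R) A.
  split=> [v|u] a x y; first exact: linA.
  by rewrite hermA linA rmorphD rmorphM /= -!hermA.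
pose m1 := bilinear_isBilinear.Build _ _ _ _ ( *%R ) (Num.conj \; *%R) A bilA.
have hA x y : A x y = (-1) ^+ false * (A y x)^* by rewrite expr0 mul1r hermA.
pose m2 := isHermitianSesquilinear.Build _ _ false Num.conj A hA.
pose B1 := HB.pack_for {hermitian_sym V for Num.conj} A m1 m2.
by exists B1.
Qed.

Lemma is_hermform_zmod : zmod_closed is_hermform.
Proof.
split=> [|A B /is_hermformP[lA hA] /is_hermformP[lB hB]]; apply/is_hermformP.
  by split=> [v a x y|u v]; rewrite ?mulr0 ?addr0 ?conjC0.
split=> [v a x y|u v]; rewrite !fctE.
  by rewrite lA lB mulrBr opprD addrACA.
by rewrite rmorphB /= -hA -hB.
Qed.
HB.instance Definition _ :=
  GRing.isZmodClosed.Build (V -> V -> C) is_hermform is_hermform_zmod.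

Record hermform := HermForm { hform :> V -> V -> C ; _ : hform \in is_hermform }.
HB.instance Definition _ := [isSub for hform].
HB.instance Definition _ := [Choice of hermform by <:].
HB.instance Definition _ := [SubChoice_isSubZmodule of hermform by <:].

Definition gram (A : V -> V -> C) : 'M[C]_n :=
  \matrix_(i, j) A (vbasis {:V})`_i (vbasis {:V})`_j.

(* The topology of the finite-dimensional real vector space Q(V), transported
   from complex matrices by A |-> gram A; C^o carries the norm topology. *)
HB.instance Definition _ := Topological.copy hermform
  (initial_topology (fun A : hermform => gram A : 'M[C^o]_n)).

(* In R[i], 0 <= z (resp. 0 < z) means that z is real and >= 0 (resp. > 0). *)
Definition semipositive : set hermform := [set P | forall v, 0 <= P v v].

Definition positive_definite : set hermform :=
  [set P | forall v, v != 0 -> 0 < P v v].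

End HermitianForms.
Arguments is_hermform {R V}.

Section RelativeEigenvalues.
Context {R : realType} {V : vectType R[i]} (rho : {dot V for Num.conj}).
Local Notation n := (\dim {:V}).

(* The eigenvalues of A relative to rho are those of the endomorphism T with
   A u v = rho (T u) v, whose matrix (acting on row vectors) is
   gram A *m invmx (gram rho); they are counted with multiplicity. *)
Definition is_eigvals (A : hermform V) (x : 'rV[R]_n) : Prop :=
  char_poly (gram A *m invmx (gram rho)) =
  \prod_(i < n) ('X - ((x 0 i)%:C%C)%:P).

Let vec (v : 'rV[R[i]]_n) : V := \sum_i v 0 i *: (vbasis {:V})`_i.

Let gramE (A : V -> V -> R[i]) (v w : 'rV[R[i]]_n) : A \in is_hermform ->
  A (vec v) (vec w) = (v *m gram A *m (map_mx Num.conj w)^T) 0 0.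
Proof.
rewrite unfold_in /= => /asboolP[B ->]; rewrite /vec linear_sumlz mxE.
under eq_bigr do rewrite linear_sumr.
rewrite exchange_big /=; apply: eq_bigr => j _.
rewrite !mxE mulr_suml; apply: eq_bigr => i _.
by rewrite linearZl_LR linearZr_LR /= !mxE mulrA mulrAC.
Qed.

Let vec_eq0 v : (vec v == 0) = (v == 0).
Proof.
apply/eqP/eqP => [v0|->]; last by rewrite /vec big1 // => i _; rewrite mxE scale0r.
apply/rowP => i; rewrite mxE.
by have /freeP := basis_free (vbasisP {:V}); apply.
Qed.

Let rho_hermform : (rho : V -> V -> R[i]) \in is_hermform.
Proof. by rewrite unfold_in; apply/asboolP; exists rho. Qed.

Let gram_unit : gram rho \in unitmx.
Proof.
rewrite -row_free_unit -kermx_eq0; apply/rowV0P => v /sub_kermxP vg0.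
have := gramE v v rho_hermform; rewrite vg0 mul0mx mxE => /eqP.
by rewrite dnorm_eq0 vec_eq0 => /eqP.
Qed.

Lemma exists_eigvals (A : hermform V) : exists x, is_eigvals A x.
Proof.
set M := gram A *m invmx (gram rho).
have hA : hform A \in is_hermform by case: A {M}.
have real_root z : root (char_poly M) z -> (complex.Re z)%:C%C = z.
  rewrite -eigenvalue_root_char => /eigenvalueP[v vM v0].
  have Avv : A (vec v) (vec v) = z * rho (vec v) (vec v).
    have gA : gram A = M *m gram rho by rewrite mulmxKV.
    by rewrite (gramE _ _ hA) (gramE _ _ rho_hermform) gA mulmxA vM -!scalemxAl mxE.
  have rho0 : 0 < rho (vec v) (vec v) by rewrite dnorm_gt0 vec_eq0.
  have /is_hermformP[_ /(_ (vec v) (vec v))] := hA.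
  rewrite Avv rmorphM /= (geC0_conj (ltW rho0)).
  move=> /(mulIf (lt0r_neq0 rho0)).
  by case: z {vM Avv} => a b [] /eqP; rewrite -addr_eq0 -mulr2n mulrn_eq0 /= => /eqP ->.
have [r Mr] := closed_field_poly_normal (char_poly M).
rewrite (monicP (char_poly_monic M)) scale1r in Mr.
have szr : size r = n.
  by have := size_char_poly M; rewrite Mr size_prod_XsubC => -[].
exists (\row_(i < n) complex.Re r`_i); rewrite /is_eigvals -/M Mr.
rewrite (big_nth 0) szr big_mkord; apply: eq_bigr => i _.
rewrite mxE real_root // Mr root_prod_XsubC mem_nth // szr.
exact: ltn_ord.
Qed.

Definition eigvals (A : hermform V) : 'rV[R]_n := xget 0 (is_eigvals A).

Definition sigma (j : nat) (A : hermform V) : R :=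
  mpeval (mesym n R j) (eigvals A).

Definition hdet (A : hermform V) : R := sigma n A.

Definition htr (A : hermform V) : R := sigma 1 A.

Definition admissible (G : hermform V -> R) (A_ : set (hermform V)) : Prop :=
  [/\ open A_,
      A_ !=set0 /\ (forall A P, A_ A -> semipositive P -> A_ (A + P)),
      (forall A P, A_ A -> positive_definite P -> G A < G (A + P)) &
      (forall A0, (closure A_ `\` interior A_) A0 ->
         (limf_esup (EFin \o G) (within A_ (nbhs A0)) <= 0)%E)].

Definition QSH (A_ : set (hermform V)) : Prop :=
  exists2 b : R, 0 <= b & forall A, A_ A -> - b <= htr A.

End RelativeEigenvalues.

(* Main.v *)
Require Import Defs.
From HB Require Import structures.
From mathcomp Require Import all_boot all_order all_algebra.
From mathcomp Require Import perm spectral sesquilinear complex.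
From mathcomp Require Import -(notations) mpoly.
From mathcomp Require Import all_classical all_reals all_analysis.
From mathcomp Require Import zify ring lra.
Import Order.TTheory GRing.Theory Num.Theory.
Import numFieldNormedType.Exports.
Local Open Scope classical_set_scope.
Local Open Scope ring_scope.
Set Implicit Arguments.
Unset Strict Implicit.
Unset Printing Implicit Defensive.

(** Write f = sum_j c_j sigma_j with c_j = a_j / C(n, j).  It is affine in each
variable, so f(x + h) = sum_K h^K D_K(x), where D_K is the derivative of f in
the variables of the index set K and h^K the product of their increments.

The cones.  The component of {D_I > 0} that passes the ray test is the set of
the x at which D_J > 0 for all J containing I with at most d elements
([garding_cone_poscone]).  By the Taylor formula this set is open and passes
the ray test, and any two of its points are joined through their coordinatewise
maximum; what has to be shown is that it is closed in {D_I > 0}.  This is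
[pder_le0]: if the D_J, J containing I + i, are nonnegative at x and D_(I + i)
vanishes there, then D_I(x) <= 0.  On the diagonal it says that the largest
root of each derivative of p dominates that of the next one, which is what the
recursive definition of a Garding polynomial gives ([garding_nested]).  To
reach a general x, its coordinates are fixed one at a time, in increasing
order.  If q_k(t) denotes the value of D_K at (t, ..., t) for K of size k,
fixing a coordinate y replaces q_k by q_k - (t - y) q_(k+1).  This preserves
the nesting for t >= y as soon as q_k q_(k+2) <= q_(k+1)^2 there
([nested_elim]), and that inequality propagates to the right because a
nonnegative log-concave sequence of Taylor coefficients stays so under a forward
translation ([laguerre_mono]).

The forms.  If A has eigenvalues l, then G(A) = f(l) is obtained from
det(1 + X A) by sending X^j to c_j, hence does not depend on a basis.  In a
basis that diagonalizes A, expanding the determinant gives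
  G(A + P) = sum_K det(P_K) D_K(l),
where P_K runs over the principal submatrices of P ([specfun_expand]).  For
P >= 0 all minors are nonnegative, for l in C_f^(1) so are the D_K with K
nonempty, and D_K = c_d if K has d elements; as the minors of order d add up
to sigma_d(P), dropping all other terms leaves the lower bound on
G(A + P) - G(A) ([spectral_gain]).
The same expansion with P replaced by P + X E, where E is a spectral
projection of A + P, shows that the eigenvalues of A + P stay in C_f^(1)
([spectral_mono]).  The second inequality is the one of arithmetic and
geometric means for the products of d eigenvalues ([maclaurin]), and QSH comes
from adding up the affine conditions D_J > 0 with d - 1 elements in J
([trace_bound]).

Openness and the boundary condition use monotonicity in place of continuity of
the eigenvalues: the forms B with A - e rho <= B <= A + e rho make up a
neighbourhood of A ([near_nform]), and adding e rho to a form adds e to each of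
its eigenvalues. *)

(* Unifies the two convertible forms that the cardinal of a set may take. *)
Ltac nlia := unfold reverse_coercion in *; lia.

(** * Symmetric multiaffine polynomials *)

Section Umbral.
Context {A : comNzRingType}.
Implicit Types (c : nat -> A) (q : {poly A}) (s : seq A) (t y : A).

(** The linear functional that sends X^j to c_j.  The coefficient of X^j in
prod_i (1 + x_i X) is sigma_j(x), so identities between such products become
identities for sum_j c_j sigma_j. *)
Definition umbral c q : A := \sum_(j < size q) c j * q`_j.

(** On coefficients with respect to the sigma_j, this is differentiation in k
distinct variables. *)
Definition shiftc k c : nat -> A := fun j => c (k + j)%N.

(** The value of sum_j c_j sigma_j at the entries of s. *)
Definition polar c s : A := umbral c (\prod_(y <- s) (1 + y%:P * 'X)).

Lemma umbral_widen c q N : (size q <= N)%N ->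
  umbral c q = \sum_(j < N) c j * q`_j.
Proof.
move=> qN; rewrite /umbral (big_ord_widen _ (fun j => c j * q`_j) qN) big_mkcond.
by apply: eq_bigr => j _; case: ltnP => // jq; rewrite nth_default ?mulr0.
Qed.

Lemma umbralD c q1 q2 : umbral c (q1 + q2) = umbral c q1 + umbral c q2.
Proof.
pose N := maxn (size q1) (size q2).
rewrite !(@umbral_widen _ _ N) ?leq_maxl ?leq_maxr ?size_polyD // -big_split /=.
by apply: eq_bigr => j _; rewrite coefD mulrDr.
Qed.

Lemma umbralZ c a q : umbral c (a *: q) = a * umbral c q.
Proof.
rewrite (@umbral_widen _ _ (size q)) ?size_scale_leq // mulr_sumr.
by apply: eq_bigr => j _; rewrite coefZ mulrCA.
Qed.

Lemma umbral0 c : umbral c 0 = 0.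
Proof. by rewrite /umbral size_poly0 big_ord0. Qed.

Lemma umbral_sum c I (r : seq I) (P : pred I) F :
  umbral c (\sum_(i <- r | P i) F i) = \sum_(i <- r | P i) umbral c (F i).
Proof. exact: (big_morph _ (umbralD c) (umbral0 c)). Qed.

Lemma umbralMXn c k q : umbral c ('X^k * q) = umbral (shiftc k c) q.
Proof.
rewrite (@umbral_widen _ _ (k + size q)); last first.
  by rewrite (leq_trans (size_polyMleq _ _)) // size_polyXn.
rewrite big_split_ord /= big1 ?add0r => [|i _].
  by apply: eq_bigr => i _; rewrite coefXnM ltnNge leq_addr addKn.
by rewrite coefXnM ltn_ord mulr0.
Qed.

Lemma umbralXn c k : umbral c 'X^k = c k.
Proof.
by rewrite -[X in umbral _ X]mulr1 umbralMXn /umbral size_poly1 big_ord1 coef1 mulr1 /shiftc addn0.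
Qed.

Lemma umbral1 c : umbral c 1 = c 0%N.
Proof. by rewrite -(umbralXn c 0) expr0. Qed.

Lemma umbral_lin c y q :
  umbral c ((1 + y%:P * 'X) * q) = umbral c q + y * umbral (shiftc 1 c) q.
Proof.
by rewrite mulrDl mul1r umbralD -mulrA mul_polyC umbralZ -(expr1 'X) umbralMXn.
Qed.

Lemma umbral_lin_seq c y q :
  umbral c ((1 + y%:P * 'X) * q) = umbral (fun j => c j + y * c j.+1) q.
Proof.
rewrite umbral_lin /umbral mulr_sumr -big_split /=.
by apply: eq_bigr => j _; rewrite mulrDl mulrA.
Qed.

Lemma shiftcS k c : shiftc k.+1 c = shiftc 1 (shiftc k c).
Proof. by apply: funext => j; rewrite /shiftc addnA addn1. Qed.

Lemma shiftcD k l c : shiftc k (shiftc l c) = shiftc (l + k) c.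
Proof. by apply: funext => j; rewrite /shiftc addnA. Qed.

Lemma shiftc0 c : shiftc 0 c = c.
Proof. by []. Qed.

Lemma polar_nil c : polar c [::] = c 0%N.
Proof. by rewrite /polar big_nil umbral1. Qed.

Lemma polar_cons c y s : polar c (y :: s) = polar c s + y * polar (shiftc 1 c) s.
Proof. by rewrite /polar big_cons umbral_lin. Qed.

(** Fixing one argument leaves a symmetric multiaffine polynomial in the
others. *)
Lemma polar_elim c y s :
  polar c (y :: s) = polar (fun j => c j + y * c j.+1) s.
Proof. by rewrite /polar big_cons umbral_lin_seq. Qed.

Lemma polar_perm c s s' : perm_eq s s' -> polar c s = polar c s'.
Proof. by move=> ss'; rewrite /polar (perm_big _ ss'). Qed.

End Umbral.

(** * Log-concave sequences *)

Section LogConcave.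
Context {R : realType}.
Implicit Types (v : nat -> R) (k M d : nat).

(** The third clause excludes zeros between positive terms: without it the
four-term inequality behind [log_concave_step] would fail. *)
Definition log_concave v k M d : Prop :=
  [/\ forall i, (k <= i <= M)%N -> 0 <= v i,
      forall i, (k <= i)%N -> (i.+2 <= M)%N -> v i * v i.+2 <= v i.+1 ^+ 2,
      forall i, (k <= i)%N -> (i < d)%N -> (i < M)%N -> v i.+1 = 0 -> v i = 0 &
      forall i, (d < i <= M)%N -> v i = 0].

Lemma log_concave_ext v w k M d :
  (forall i, (k <= i <= M)%N -> v i = w i) -> (k <= d)%N ->
  log_concave v k M d -> log_concave w k M d.
Proof.
move=> vw kd [v0 vL vz vd]; split.
- by move=> i iM; rewrite -vw ?v0.
- by move=> i ki iM; rewrite -!vw ?vL //; lia.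
- by move=> i ki id iM; rewrite -!vw; [apply: vz|lia|lia].
- by move=> i /andP[di iM]; rewrite -vw ?vd ?di //; lia.
Qed.

(** Writing a, b, c, e for four consecutive terms, the new inequality also
needs a e <= b c, which is the product of a c <= b^2 and b e <= c^2
divided by b c, and if b or c vanishes then so does a. *)
Lemma log_concave_step v tau k M d : 0 <= tau -> (k <= d)%N ->
  log_concave v k M.+1 d -> log_concave (fun i => v i + tau * v i.+1) k M d.
Proof.
move=> tau0 kd [v0 vL vz vd]; split.
- by move=> i iM; rewrite addr_ge0 ?mulr_ge0 ?v0 //; lia.
- move=> i ki iM.
  have a0 : 0 <= v i by apply: v0; lia.
  have b0 : 0 <= v i.+1 by apply: v0; lia.
  have c0 : 0 <= v i.+2 by apply: v0; lia.
  have e0 : 0 <= v i.+3 by apply: v0; lia.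
  have acb : v i * v i.+2 <= v i.+1 ^+ 2 by apply: vL => //; lia.
  have bec : v i.+1 * v i.+3 <= v i.+2 ^+ 2 by apply: vL => //; lia.
  have aebc : v i * v i.+3 <= v i.+1 * v i.+2.
    have [id3|id3] := ltnP d i.+3.
      by rewrite (vd i.+3) ?mulr0 ?mulr_ge0 //; lia.
    have [z2|nz2] := eqVneq (v i.+2) 0.
      have z1 : v i.+1 = 0 by apply: vz => //; lia.
      have z : v i = 0 by apply: vz => //; lia.
      by rewrite z z1 !mul0r.
    have [z1|nz1] := eqVneq (v i.+1) 0.
      have z : v i = 0 by apply: vz => //; lia.
      by rewrite z z1 !mul0r.
    have c1 : 0 < v i.+2 by rewrite lt_def nz2.
    have b1 : 0 < v i.+1 by rewrite lt_def nz1.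
    rewrite -(ler_pM2r (mulr_gt0 b1 c1)).
    have -> : v i * v i.+3 * (v i.+1 * v i.+2)
            = (v i * v i.+2) * (v i.+1 * v i.+3) by ring.
    have -> : v i.+1 * v i.+2 * (v i.+1 * v i.+2)
            = v i.+1 ^+ 2 * v i.+2 ^+ 2 by ring.
    by apply: ler_pM; rewrite ?mulr_ge0.
  rewrite -subr_ge0.
  have -> : (v i.+1 + tau * v i.+2) ^+ 2
    - (v i + tau * v i.+1) * (v i.+2 + tau * v i.+3)
    = (v i.+1 ^+ 2 - v i * v i.+2) + tau * (v i.+1 * v i.+2 - v i * v i.+3)
    + tau ^+ 2 * (v i.+2 ^+ 2 - v i.+1 * v i.+3) by ring.
  apply: addr_ge0; first (apply: addr_ge0; first by rewrite subr_ge0).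
    by rewrite mulr_ge0 // subr_ge0.
  by rewrite mulr_ge0 ?exprn_ge0 // subr_ge0.
- move=> i ki id iM.
  have a0 : 0 <= v i by apply: v0; lia.
  have b0 : 0 <= v i.+1 by apply: v0; lia.
  have c0 : 0 <= v i.+2 by apply: v0; lia.
  move/eqP; rewrite paddr_eq0 ?mulr_ge0 // => /andP[/eqP z1 _].
  have z : v i = 0 by apply: vz => //; lia.
  by rewrite z z1 mulr0 addr0.
- by move=> i /andP[di iM]; rewrite !vd ?mulr0 ?addr0 //; lia.
Qed.

End LogConcave.

(** * Diagonal values and elimination of variables *)

Section Diagonal.
Context {R : realType}.
Implicit Types (c : nat -> R) (m d k : nat) (s : seq R) (t y : R).

(** With m variables in all, the value at (t, ..., t) of a derivative in k of
them; up to a positive factor this is the k-th derivative of the univariate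
polynomial ([diagp_derivn]). *)
Definition diagp c m k t : R := polar (shiftc k c) (nseq (m - k) t).

(** Moving the arguments from t0 to t one by one interpolates between the
diagonal values at t0 and at t. *)
Definition mixed c t t0 r r' i : R :=
  polar (shiftc i c) (nseq r t ++ nseq r' t0).

Lemma mixed_step c t t0 r r' i :
  mixed c t t0 r.+1 r' i
  = mixed c t t0 r r'.+1 i + (t - t0) * mixed c t t0 r r' i.+1.
Proof.
have -> : mixed c t t0 r r'.+1 i
        = polar (shiftc i c) (t0 :: nseq r t ++ nseq r' t0).
  apply: polar_perm.
  by rewrite -[nseq r'.+1 t0]/([:: t0] ++ nseq r' t0) perm_catCA.
by rewrite /mixed /= !polar_cons -shiftcS; ring.
Qed.

Lemma diagp_mixedl c m k t t0 : diagp c m k t = mixed c t t0 (m - k) 0 k.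
Proof. by rewrite /mixed cats0. Qed.

Lemma diagp_mixedr c m k t t0 : diagp c m k t0 = mixed c t t0 0 (m - k) k.
Proof. by []. Qed.

Lemma mixed_ge0 c m k t t0 : t0 <= t ->
  (forall j, (k <= j <= m)%N -> 0 <= diagp c m j t0) ->
  forall r r' i, (k <= i)%N -> (i + r + r' = m)%N -> 0 <= mixed c t t0 r r' i.
Proof.
move=> t0t q0; elim=> [|r IHr] r' i ki im.
  have -> : r' = (m - i)%N by lia.
  by rewrite -diagp_mixedr q0 //; lia.
rewrite mixed_step addr_ge0 ?mulr_ge0 ?subr_ge0 ?IHr //; lia.
Qed.

(** The first argument to move contributes the linear term, and the later ones
can only increase the value. *)
Lemma diagp_growth c m k t t0 : t0 <= t -> (k < m)%N ->
  (forall j, (k < j <= m)%N -> 0 <= diagp c m j t0) ->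
  diagp c m k t0 + (t - t0) * diagp c m k.+1 t0 <= diagp c m k t.
Proof.
move=> t0t km q0.
have step r : (k + r.+1 <= m)%N ->
    mixed c t t0 1 (m - k).-1 k <= mixed c t t0 r.+1 (m - k - r.+1) k.
  elim: r => [|r IHr] km1; first by rewrite -subn1 -subnDA.
  apply: le_trans (IHr _) _; first lia.
  rewrite (mixed_step _ _ _ r.+1).
  have -> : (m - k - r.+1 = (m - k - r.+2).+1)%N by lia.
  rewrite lerDl mulr_ge0 ?subr_ge0 //.
  by apply: (mixed_ge0 t0t q0); lia.
have := step (m - k).-1 ltac:(lia).
have -> : ((m - k).-1.+1 = m - k)%N by lia.
rewrite subnn -diagp_mixedl => h; apply: le_trans h.
rewrite mixed_step.
have -> : ((m - k).-1.+1 = m - k)%N by lia.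
rewrite (diagp_mixedr _ _ _ t) lerD2l.
by rewrite (diagp_mixedr _ _ _ t); have -> : (m - k.+1 = (m - k).-1)%N by lia.
Qed.

Lemma diagp_mono c m k t t0 : t0 <= t -> (k <= m)%N ->
  (forall j, (k < j <= m)%N -> 0 <= diagp c m j t0) ->
  diagp c m k t0 <= diagp c m k t.
Proof.
rewrite leq_eqVlt => t0t /orP[/eqP ->|km] q0.
  by rewrite /diagp subnn.
apply: le_trans (diagp_growth t0t km q0).
by rewrite lerDl mulr_ge0 ?subr_ge0 ?q0 ?km ?ltnSn.
Qed.

Lemma continuous_polar c r : continuous (fun t => polar c (nseq r t)).
Proof.
elim: r c => [|r IHr] c t /=; first exact: cvg_cst.
under eq_fun do rewrite polar_cons.
apply: cvgD; first exact: IHr.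
by apply: cvgM; [exact: cvg_id|exact: IHr].
Qed.

Lemma diagp_eq0 c m d j t : (forall i, (d < i <= m)%N -> c i = 0) ->
  (d < j <= m)%N -> diagp c m j t = 0.
Proof.
move=> cd dj; rewrite /diagp /polar /umbral big1 // => i _.
have szle : (size (\prod_(y <- nseq (m - j) t) (1 + y%:P * 'X))%R <= (m - j).+1)%N.
  elim: (m - j)%N => [|r IHr] /=; first by rewrite big_nil size_poly1.
  rewrite big_cons (leq_trans (size_polyMleq _ _)) //.
  rewrite (@leq_trans (2 + r.+1).-1) //.
  have : (size (1 + t%:P * 'X : {poly R})%R <= 2)%N.
    rewrite (leq_trans (size_polyD _ _)) // size_poly1 geq_max /=.
    by rewrite mul_polyC (leq_trans (size_scale_leq _ _)) // size_polyX.
  move: IHr; set u := size _; set w := size _; lia.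
rewrite /shiftc cd ?mul0r //.
have := leq_trans (ltn_ord i) szle; move: (nat_of_ord i) => i0; lia.
Qed.

(** The largest root of each derivative dominates that of the next one.  Saying
so without mentioning roots gives a condition that can be restricted to a half
line and survives the elimination of variables. *)
Definition nested c m d y0 : Prop := forall t k, y0 <= t -> (k < d)%N ->
  (forall j, (k < j <= m)%N -> 0 <= diagp c m j t) ->
  diagp c m k.+1 t = 0 -> diagp c m k t <= 0.

(** The analogue of the Newton inequalities between successive derivatives, in
the range where the higher ones are nonnegative. *)
Definition laguerre c m t : Prop := forall k, (k.+2 <= m)%N ->
  (forall j, (k < j <= m)%N -> 0 <= diagp c m j t) ->
  diagp c m k t * diagp c m k.+2 t <= diagp c m k.+1 t ^+ 2.

(** Nesting transports a zero from one derivative to the preceding one, whose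
value is then both nonnegative and nonpositive. *)
Lemma nested_chain c m d y0 t k j : nested c m d y0 -> y0 <= t ->
  (d <= m)%N -> (k <= j <= d)%N ->
  (forall i, (k <= i <= m)%N -> 0 <= diagp c m i t) ->
  diagp c m j t = 0 -> diagp c m k t = 0.
Proof.
move=> N y0t dm; elim: j => [|j IHj] kjd q0 qj.
  by have -> : k = 0%N by lia.
have [-> //|kj] := eqVneq k j.+1.
apply: IHj => //; first lia.
apply/eqP; rewrite eq_le q0 ?andbT; last lia.
apply: (N t) => //; first lia.
by move=> i ij; apply: q0; lia.
Qed.

(** Move left from t for as long as the values of order at least k stay
nonnegative.  If the motion stops before y0, one of these values vanishes, and
by [nested_chain] the one of order k does. *)
Lemma nonneg_entry c m d y0 t k : (forall i, (d < i <= m)%N -> c i = 0) ->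
  (k <= d <= m)%N -> nested c m d y0 -> y0 <= t ->
  (forall i, (k <= i <= m)%N -> 0 <= diagp c m i t) ->
  exists t0, [/\ y0 <= t0 <= t,
    forall i, (k <= i <= m)%N -> 0 <= diagp c m i t0 &
    t0 = y0 \/ diagp c m k t0 = 0].
Proof.
move=> cd kdm N y0t q0.
pose S := [set s | y0 <= s <= t /\
  forall i, (k <= i <= m)%N -> 0 <= diagp c m i s].
have St : S t by split; rewrite ?y0t ?lexx.
have Slb : lbound S y0 by move=> s [/andP[]].
have infS : has_inf S by split; [exists t|exists y0].
have y0i : y0 <= inf S by apply: lb_le_inf => //; exists t.
have it : inf S <= t by apply: ge_inf => //; exists y0.
have contq i : continuous (diagp c m i) by apply: continuous_polar.
have qi i : (k <= i <= m)%N -> 0 <= diagp c m i (inf S).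
  move=> kim; rewrite leNgt; apply/negP => qneg.
  have : \forall s \near inf S, diagp c m i s < 0.
    exact: (contq i (inf S) _ (lt_nbhsl qneg)).
  move=> /nbhs_ballP[e /= e0 He].
  have [s [/andP[y0s st] qs] se] := inf_adherent e0 infS.
  have /He : ball (inf S) e s.
    rewrite /ball /= ltr_distlC.
    have : inf S <= s by apply: ge_inf; [exists y0|split=> //; rewrite y0s].
    by move=> iSs; rewrite se andbT; lra.
  by rewrite ltNge qs.
exists (inf S); split=> //; first by rewrite y0i.
have [-> | ny0] := eqVneq (inf S) y0; first by left.
right.
have [/existsP[j /andP[kj /eqP qj]]|/existsPn noz] :=
    boolP [exists j : 'I_d.+1, (k <= j)%N && (diagp c m j (inf S) == 0)].
  by apply: (nested_chain N y0i _ _ _ qj) => //; have := ltn_ord j; lia.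
exfalso.
have near_pos : \forall s \near inf S,
    forall j : 'I_d.+1, (k <= j)%N -> 0 < diagp c m j s.
  apply: (@filter_forall R 'I_d.+1 (fun j u =>
    (k <= j)%N -> 0 < diagp c m j u) (nbhs (inf S)) _) => j.
  have [kj|kj] := leqP k j; last by near=> s.
  have qpos : 0 < diagp c m j (inf S).
    have := noz j; rewrite kj /= lt_def => -> /=.
    by apply: qi; have := ltn_ord j; lia.
  have near1 : \forall u \near inf S, 0 < diagp c m j u.
    exact: (contq j (inf S) _ (lt_nbhsr qpos)).
  by near do move=> _.
have {near_pos} /nbhs_ballP[e /= e0 He] := near_pos.
pose s := Num.max y0 (inf S - e / 2).
have y0lt : y0 < inf S by rewrite lt_def ny0.
have sS : s < inf S by rewrite gt_max y0lt /=; lra.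
have : S s.
  split; first by rewrite le_max lexx /= (le_trans (ltW sS)).
  move=> i kim.
  have [di|id] := ltnP d i; first by rewrite (diagp_eq0 _ cd) // di; lia.
  have /He/(_ (Ordinal (id : i < d.+1)%N))/= : ball (inf S) e s.
    rewrite /ball /= ltr_distl; apply/andP; split; first by lra.
    have : inf S - e / 2 <= s by rewrite le_max lexx orbT.
    by lra.
  by move=> h; apply/ltW/h; lia.
by move/(ge_inf (ex_intro _ y0 Slb)); rewrite leNgt sS.
Unshelve. all: by end_near.
Qed.

(** Downward induction on k.  If the value of order k is positive at t, move
left to the point t0 of [nonneg_entry], where the values of order at least k are
nonnegative and log-concave: at order k because t0 = y0 or the product vanishes,
at higher orders by induction.  Translating forward from t0 to t multiplies by
linear factors, which keeps log-concavity. *)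
Lemma laguerre_mono c m d y0 : (forall i, (d < i <= m)%N -> c i = 0) ->
  (d <= m)%N -> nested c m d y0 -> laguerre c m y0 ->
  forall t, y0 <= t -> laguerre c m t.
Proof.
move=> cd dm N L t y0t k km; move: {2}(d - k)%N (leqnn (d - k)) => e.
elim: e k t y0t km => [|e IHe] k t y0t km dk q0.
  rewrite (diagp_eq0 (j := k.+2) _ cd) ?mulr0 ?sqr_ge0 //; lia.
have [k2d|dk2] := leqP k.+2 d; last first.
  rewrite (diagp_eq0 (j := k.+2) _ cd) ?mulr0 ?sqr_ge0 //; lia.
have [qk0|qk0] := leP (diagp c m k t) 0.
  apply: le_trans (sqr_ge0 _); rewrite mulr_le0_ge0 // q0 //; lia.
have q0' i : (k <= i <= m)%N -> 0 <= diagp c m i t.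
  by case: (eqVneq i k) => [-> _|ik kim]; [exact: ltW|apply: q0; lia].
have kdm : (k <= d <= m)%N by lia.
have [t0 [/andP[y0t0 t0t] q00 t0E]] := nonneg_entry cd kdm N y0t q0'.
have L0 i : (k <= i)%N -> (i.+2 <= m)%N ->
    diagp c m i t0 * diagp c m i.+2 t0 <= diagp c m i.+1 t0 ^+ 2.
  move=> ki im; have q0i j : (i < j <= m)%N -> 0 <= diagp c m j t0.
    by move=> ijm; apply: q00; lia.
  have [ik|ik] := eqVneq i k.
    case: t0E => [t0y|qk]; first by rewrite t0y; apply: L => //; rewrite -t0y.
    by rewrite ik qk mul0r sqr_ge0.
  by apply: IHe => //; lia.
pose w r i := mixed c t t0 r (m - i - r) i.
have LC r : (k + r <= m)%N -> log_concave (w r) k (m - r) d.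
  elim: r => [|r IHr] krm.
    rewrite subn0; apply: (@log_concave_ext _ (fun i => diagp c m i t0)).
    - by move=> i _; rewrite /w subn0.
    - lia.
    - split=> //.
      + move=> i ki id im qi; apply: (nested_chain (j := i.+1) N y0t0) => //; first lia.
        by move=> j jm; apply: q00; lia.
      + by move=> i dim; apply: diagp_eq0 cd dim.
  apply: (@log_concave_ext _ (fun i => w r i + (t - t0) * w r i.+1)).
  - move=> i ikm; rewrite /w mixed_step.
    have -> : (m - i - r = (m - i - r.+1).+1)%N by lia.
    by have -> : (m - i.+1 - r = m - i - r.+1)%N by lia.
  - lia.
  - apply: log_concave_step; [by rewrite subr_ge0|lia|].
    by have -> : ((m - r.+1).+1 = m - r)%N; [lia|apply: IHr; lia].
have [_ /(_ k (leqnn k)) + _ _] := LC (m - k.+2)%N ltac:(lia).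
set r := (m - k.+2)%N => /(_ ltac:(lia)).
have -> : w r k = mixed c t t0 r 2 k by rewrite /w; congr (mixed _ _ _ _ _ _); lia.
have -> : w r k.+1 = mixed c t t0 r 1 k.+1 by rewrite /w; congr (mixed _ _ _ _ _ _); lia.
have -> : w r k.+2 = mixed c t t0 r 0 k.+2 by rewrite /w; congr (mixed _ _ _ _ _ _); lia.
rewrite !(diagp_mixedl _ _ _ t t0).
have -> : (m - k = r.+2)%N by lia.
have -> : (m - k.+1 = r.+1)%N by lia.
have -> : (m - k.+2 = r)%N by lia.
rewrite !mixed_step; set u := mixed _ _ _ _ _ _; set v := mixed _ _ _ _ _ _.
set z := mixed _ _ _ _ _ _ => uzv.
rewrite -subr_ge0 [X in 0 <= X](_ : _ = z ^+ 2 - u * v); last by ring.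
by rewrite subr_ge0.
Qed.

(** With one variable fixed at y, a diagonal point in the remaining ones differs
from the full diagonal point in a single coordinate. *)
Lemma diagp_elim c m k t y : (k < m)%N ->
  diagp (fun j => c j + y * c j.+1) m.-1 k t
  = diagp c m k t - (t - y) * diagp c m k.+1 t.
Proof.
move=> km; rewrite /diagp.
have -> : (m - k = (m.-1 - k).+1)%N by lia.
have -> : (m - k.+1 = m.-1 - k)%N by lia.
rewrite polar_cons.
have -> : shiftc k (fun j => c j + y * c j.+1)
        = (fun j => shiftc k c j + y * shiftc k c j.+1).
  by apply: funext => j; rewrite /shiftc addnS.
by rewrite -polar_elim polar_cons -shiftcS; ring.
Qed.

(** Let q_k be the old values and u = t - y >= 0, so that the new ones are
q_k - u q_(k+1).  Where the new values of order above k are nonnegative, so are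
the old ones, starting from the top one.  If moreover q_(k+1) = u q_(k+2), the
Laguerre inequality divided by q_(k+2) gives q_k <= u q_(k+1).  At t = y old and
new values agree. *)
Lemma nested_elim c m d y : (forall i, (d < i <= m)%N -> c i = 0) ->
  (0 < m)%N -> (d <= m)%N -> nested c m d y -> laguerre c m y ->
  0 <= c m -> 0 <= c m.-1 + y * c m ->
  let c' := fun j => c j + y * c j.+1 in let d' := minn d m.-1 in
  [/\ forall i, (d' < i <= m.-1)%N -> c' i = 0,
      nested c' m.-1 d' y & laguerre c' m.-1 y].
Proof.
move=> cd m0 dm N L cm cm1 c' d'.
have cE k t : (k < m)%N -> diagp c' m.-1 k t
  = diagp c m k t - (t - y) * diagp c m k.+1 t by exact: diagp_elim.
have qm t : diagp c m m t = c m.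
  by rewrite /diagp subnn polar_nil /shiftc addn0.
have q_pos t k : y <= t -> (k < m)%N ->
    (forall j, (k <= j <= m.-1)%N -> 0 <= diagp c' m.-1 j t) ->
    forall j, (k <= j <= m)%N -> 0 <= diagp c m j t.
  move=> yt km q0 j kjm; move: {2}(m - j)%N (leqnn (m - j)) => e.
  elim: e j kjm => [|e IHe] j kjm mj.
    by have -> : j = m; [lia|rewrite qm].
  have [->|jm] := eqVneq j m; first by rewrite qm.
  have := q0 j ltac:(lia); rewrite cE ?subr_ge0; last lia.
  by apply: le_trans; rewrite mulr_ge0 ?subr_ge0 ?IHe //; lia.
split.
- move=> i di; rewrite /c' !cd ?mulr0 ?addr0 //; rewrite /d' in di; lia.
- move=> t k yt kd q0 /eqP.
  rewrite /d' in kd.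
  have kpos := @q_pos t k.+1 yt ltac:(lia) _.
  have [km|km] := eqVneq k.+1 m.
    by exfalso; lia.
  rewrite !cE; try lia.
  rewrite subr_eq0 => /eqP q1.
  have {}kpos := kpos (fun j jm => q0 j jm).
  have q2 : 0 <= diagp c m k.+2 t by apply: kpos; lia.
  have [z2|nz2] := eqVneq (diagp c m k.+2 t) 0.
    rewrite z2 mulr0 in q1; rewrite q1 mulr0 subr0.
    by apply: N => //; lia.
  have {nz2}q2 : 0 < diagp c m k.+2 t by rewrite lt_def nz2.
  have /(_ k ltac:(lia) kpos) := laguerre_mono cd dm N L yt.
  rewrite expr2 {2}q1 mulrA ler_pM2r // => h.
  by rewrite subr_le0 mulrC.
- move=> k km q0; rewrite !cE; try lia.
  rewrite subrr !mul0r !subr0; apply: L; first lia.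
  by apply: (@q_pos y k.+1 (lexx _)) => //; lia.
Qed.

(** The variables are eliminated in increasing order because [nested_elim] keeps
the information only to the right of the eliminated value.  The positivity
hypotheses are the ones for the top coefficients met on the way. *)
Lemma polar_le0_sorted c m d s y0 : (m = (size s).+1)%N -> (0 < d <= m)%N ->
  sorted <=%R (y0 :: s) ->
  (forall i, (d < i <= m)%N -> c i = 0) -> nested c m d y0 ->
  laguerre c m y0 ->
  (forall r, (r <= size s)%N -> 0 <= polar (shiftc r.+1 c) (take (size s - r) s)) ->
  polar (shiftc 1 c) s = 0 -> polar c s <= 0.
Proof.
elim: s c m d y0 => [|y s IHs] c m d y0 mE dm srt cd N L pos.
  move=> c1; rewrite {}mE /= in dm N *.
  have d1 : d = 1%N by lia.
  rewrite d1 in N.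
  have q1 t : diagp c 1 1 t = 0 by rewrite /diagp subnn.
  have q0 j : (0 < j <= 1)%N -> 0 <= diagp c 1 j y0.
    by move=> jm; have -> : j = 1%N; [lia|rewrite q1].
  have := N y0 0%N (lexx _) isT q0 (q1 y0).
  by rewrite /diagp /= shiftc0 polar_cons c1 mulr0 addr0.
have [y0y srt'] : y0 <= y /\ sorted <=%R (y :: s) by move: srt => /= /andP[].
have L' : laguerre c m y by apply: (laguerre_mono cd _ N) => //; lia.
have N' : nested c m d y by move=> t k yt; apply: N; apply: le_trans yt.
have cm0 : 0 <= c m.
  have := pos (size s).+1 (leqnn _).
  by rewrite subnn /= polar_nil /shiftc addn0 mE.
have cm1 : 0 <= c m.-1 + y * c m.
  have := pos (size s) ltac:(rewrite /=; lia).
  rewrite [size (_ :: _)]/= subSnn /= take0 polar_cons !polar_nil /shiftc.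
  by rewrite mE /= addn0 addnA !addn1 addSn addn0.
have [cd' N'' L''] := nested_elim cd ltac:(lia) ltac:(lia) N' L' cm0 cm1.
rewrite !polar_elim => p1.
apply: (IHs _ m.-1 _ y _ _ srt' cd' N'' L'') => //.
- by rewrite mE.
- by rewrite /= in mE; lia.
- move=> r rs.
  have := pos r ltac:(rewrite /=; lia).
  rewrite [size _]/= subSn // take_cons /= polar_elim.
  by congr (0 <= polar _ _); apply: funext => j; rewrite /shiftc /= addnS.
Qed.

End Diagonal.

(** * Partial derivatives in distinct variables *)

Section PartialDerivatives.
Context {A : comNzRingType} {n : nat}.
Implicit Types (c : nat -> A) (x y : 'rV[A]_n) (I J : {set 'I_n}) (i : 'I_n).

(** The partial derivative of sum_j c_j sigma_j in the variables indexed by I. *)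
Definition pder c I x : A :=
  umbral (shiftc #|I| c) (\prod_(i in ~: I) (1 + (x 0 i)%:P * 'X)).

Lemma pder_polar c I x (s : seq 'I_n) : uniq s -> (forall i, (i \in s) = (i \notin I)) ->
  pder c I x = polar (shiftc #|I| c) [seq x 0 i | i <- s].
Proof.
move=> us sI; rewrite /pder /polar big_map big_uniq //=.
by congr umbral; apply: eq_bigl => i; rewrite inE -sI.
Qed.

Lemma pder_ext c I x y : (forall i, i \notin I -> x 0 i = y 0 i) ->
  pder c I x = pder c I y.
Proof.
by move=> xy; congr umbral; apply: eq_bigr => i; rewrite inE => iI; rewrite xy.
Qed.

Lemma pder_update c I x y i : i \notin I ->
  (forall j, j != i -> x 0 j = y 0 j) ->
  pder c I y = pder c I x + (y 0 i - x 0 i) * pder c (i |: I) x.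
Proof.
move=> iI xy; have expand z : pder c I z =
    umbral (shiftc #|I| c) (\prod_(j in ~: (i |: I)) (1 + (z 0 j)%:P * 'X))
    + z 0 i * pder c (i |: I) z.
  rewrite /pder (bigD1 i) ?inE //= umbral_lin cardsU1 iI add1n -shiftcS.
  by congr (umbral _ _ + _ * umbral _ _);
    apply: eq_bigl => j; rewrite !inE negb_or andbC.
rewrite !expand (_ : pder c (i |: I) y = pder c (i |: I) x); last first.
  by apply: pder_ext => j; rewrite !inE negb_or => /andP[ji _]; rewrite xy.
rewrite (_ : umbral _ _ = umbral (shiftc #|I| c)
   (\prod_(j in ~: (i |: I)) (1 + (x 0 j)%:P * 'X))); first by ring.
congr umbral; apply: eq_bigr => j; rewrite !inE negb_or => /andP[ji _].
by rewrite xy.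
Qed.

End PartialDerivatives.

Lemma polar_affine (A : comNzRingType) (c : nat -> A) (s : seq A) :
  (forall j, (1 < j)%N -> c j = 0) -> polar c s = c 0%N + c 1%N * \sum_(y <- s) y.
Proof.
have constant (e : nat -> A) r : (forall j, (0 < j)%N -> e j = 0) ->
    polar e r = e 0%N.
  elim: r e => [|y r IHr] e e0; first by rewrite polar_nil.
  rewrite polar_elim IHr => [|j j0]; first by rewrite (e0 1%N) // mulr0 addr0.
  by rewrite !e0 // mulr0 addr0.
move=> c0; elim: s => [|y s IHs]; first by rewrite polar_nil big_nil mulr0 addr0.
rewrite polar_cons IHs constant => [|j j0]; last by rewrite /shiftc c0.
by rewrite big_cons /shiftc; ring.
Qed.

(** * Garding components as cones of positivity *)

Section Cones.
Context {R : realType} {n : nat} (c : nat -> R) (d : nat).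
Hypotheses (dn : (d <= n)%N) (cd : forall j, (d < j)%N -> c j = 0).
Hypotheses (cd0 : 0 < c d) (nest : forall y0, nested c n d y0).
Implicit Types (x y : 'rV[R]_n) (I J : {set 'I_n}) (i : 'I_n).

Lemma pder_const I t : pder c I (const_mx t) = diagp c n #|I| t.
Proof.
rewrite /diagp /pder /polar; congr umbral.
under eq_bigr do rewrite mxE.
rewrite prodr_const cardsCs finset.setCK card_ord; elim: (n - #|I|)%N => [|r IHr].
  by rewrite big_nil.
by rewrite exprS IHr big_cons.
Qed.

Lemma pder_top I x : #|I| = d -> pder c I x = c d.
Proof.
move=> Id; rewrite (@pder_polar _ _ _ _ _ (enum (~: I))) ?enum_uniq //; last first.
  by move=> i; rewrite mem_enum inE.
rewrite polar_affine => [|j j1]; last first.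
  by rewrite /shiftc cd // Id -[ltnLHS]addn0 ltn_add2l (ltn_trans _ j1).
by rewrite /shiftc Id addn0 (@cd (d + 1)) ?mul0r ?addr0 // addn1.
Qed.

Lemma pder_over I x : (d < #|I|)%N -> pder c I x = 0.
Proof.
move=> Id; rewrite /pder /umbral big1 // => j _.
by rewrite /shiftc cd ?mul0r // ltn_addr.
Qed.

(** Since the derivative in the variable i vanishes, the value does not depend on
x_i, and the other variables outside I are eliminated in increasing order. *)
Lemma pder_le0 I i x : i \notin I -> (#|I| < d)%N ->
  (forall J, i |: I \subset J -> 0 <= pder c J x) ->
  pder c (i |: I) x = 0 -> pder c I x <= 0.
Proof.
move=> iI Id pos z.
pose idx := sort (fun j k => x 0 j <= x 0 k) (enum (~: (i |: I))).
pose s := [seq x 0 j | j <- idx].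
have uidx : uniq idx by rewrite sort_uniq enum_uniq.
have midx j : (j \in idx) = (j \notin i |: I) by rewrite mem_sort mem_enum inE.
have szidx : size idx = (n - #|I| - 1)%N.
  by have := cardsC (i |: I); rewrite size_sort -cardE cardsU1 iI card_ord; nlia.
have srt : sorted <=%R s.
  rewrite sorted_map; apply: sort_sorted => j k.
  exact: le_total.
pose c' := shiftc #|I| c; pose m := (n - #|I|)%N; pose d' := (d - #|I|)%N.
have qE j t : diagp c' m j t = diagp c n (#|I| + j) t.
  by rewrite /diagp shiftcD subnDA.
have In : (#|I| < n)%N by nlia.
have cI : #|i |: I| = #|I|.+1 by rewrite cardsU1 iI.
have key0 : pder c I x = polar c' s + x 0 i * pder c (i |: I) x.
  rewrite (@pder_polar _ _ _ _ _ (i :: idx)).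
  - rewrite (@pder_polar _ _ _ _ _ idx) // -/c' /= polar_cons -/s.
    by rewrite -shiftcS cI.
  - by rewrite /= uidx midx setU11.
  - by move=> j; rewrite inE midx !inE; case: eqVneq => [->|].
have zs : polar (shiftc 1 c') s = 0.
  by rewrite -shiftcS -cI -[RHS]z (@pder_polar _ _ _ _ _ idx).
rewrite key0 z mulr0 addr0.
(* At B the linear derivative q_(d-1) equals -1.  Starting at a point y0 <= B
makes the Laguerre inequality there trivial: for k + 2 <= d its hypotheses would
require q_(d-1) to be nonnegative, and for larger k the value q_(k+2) is 0. *)
pose B := - (c' d'.-1 + 1) / (c d * (n - d).+1%:R).
pose y0 := Num.min (head 0 s) B.
have cpos : 0 < c d * (n - d).+1%:R by rewrite mulr_gt0 ?ltr0Sn.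
have qneg : diagp c' m d'.-1 y0 < 0.
  rewrite /diagp polar_affine => [|j j1]; last first.
    by rewrite /shiftc /c' /shiftc cd //; nlia.
  have -> : shiftc d'.-1 c' 0 = c' d'.-1 by rewrite /shiftc addn0.
  have -> : shiftc d'.-1 c' 1 = c d by rewrite /shiftc /c' /shiftc; congr c; nlia.
  have -> : (m - d'.-1 = (n - d).+1)%N by nlia.
  rewrite big_nseq iter_addr addr0 -mulr_natr mulrCA.
  have : y0 * (c d * (n - d).+1%:R) <= B * (c d * (n - d).+1%:R).
    by rewrite ler_pM2r // ge_min lexx orbT.
  have -> : B * (c d * (n - d).+1%:R) = - (c' d'.-1 + 1) by rewrite divfK ?gt_eqF.
  by lra.
apply: (@polar_le0_sorted _ c' m d' s y0 _ _ _ _ _ _ _ zs).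
- by rewrite size_map szidx /m; nlia.
- by rewrite /m /d'; nlia.
- by move: srt; rewrite /y0; case: (s) => //= a r ->; rewrite ge_min lexx.
- by move=> j jd; rewrite /c' /shiftc cd //; nlia.
- move=> t k yt kd q0; rewrite !qE addnS => q1.
  apply: (nest (lexx t)) => // [|j jn]; first nlia.
  have := q0 (j - #|I|)%N ltac:(nlia); rewrite qE.
  by have -> : (#|I| + (j - #|I|) = j)%N by nlia.
- move=> k km q0; have [kd|dk] := leqP k.+2 d'.
    by move: qneg; rewrite ltNge q0 //; nlia.
  rewrite (@diagp_eq0 _ _ _ d' k.+2) ?mulr0 ?sqr_ge0 // => [j dj|]; last nlia.
  by rewrite /c' /shiftc cd //; nlia.
move=> r; rewrite size_map => rs.
pose J := ~: [set j in take (size idx - r) idx].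
have cJ : #|J| = (#|I| + r.+1)%N.
  rewrite cardsCs finset.setCK card_ord cardsE.
  rewrite (card_uniqP (take_uniq _ uidx)) size_take szidx.
  by case: ltnP; nlia.
have IJ : i |: I \subset J.
  apply/fintype.subsetP => j jI; rewrite !inE; apply/negP => /mem_take.
  by rewrite midx jI.
have := pos J IJ.
rewrite (@pder_polar _ _ _ _ _ (take (size idx - r) idx)) ?take_uniq //.
  by rewrite cJ map_take /c' shiftcD.
by move=> j; rewrite !inE negbK.
Qed.

(** If I0 has at most d elements, this is the Garding component of the derivative
in the variables of I0 ([garding_cone_poscone]). *)
Definition poscone I0 : set 'rV[R]_n :=
  [set x | forall I, I0 \subset I -> (#|I| <= d)%N -> 0 < pder c I x].

Lemma pder_ge0_all I0 x :
  (forall I, I0 \subset I -> (#|I| <= d)%N -> 0 <= pder c I x) ->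
  forall I, I0 \subset I -> 0 <= pder c I x.
Proof.
move=> h I II; have [/h|/pder_over ->//] := leqP #|I| d.
exact.
Qed.

Lemma poscone_ge0 I0 x : poscone I0 x -> forall I, I0 \subset I -> 0 <= pder c I x.
Proof.
move=> Ux; apply: pder_ge0_all => I ? ?; apply/ltW; exact: Ux.
Qed.

Lemma posconeS I0 I1 : I0 \subset I1 -> poscone I0 `<=` poscone I1.
Proof. by move=> I01 x Ux I I1I; apply: Ux; apply: fintype.subset_trans I1I. Qed.

(** Raise the coordinates one at a time; each step adds the increment times a
derivative of higher order. *)
Lemma pder_mono I0 x y : (forall i, x 0 i <= y 0 i) ->
  (forall I, I0 \subset I -> 0 <= pder c I x) ->
  forall I, I0 \subset I -> pder c I x <= pder c I y.
Proof.
move=> xy pos.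
pose z (r : seq 'I_n) : 'rV[R]_n := \row_i if i \in r then y 0 i else x 0 i.
have zr r I : I0 \subset I -> pder c I x <= pder c I (z r).
  elim: r I => [|i r IHr] I II.
    rewrite (_ : z [::] = x) //.
    by apply/rowP => i; rewrite mxE.
  have zE j : j != i -> z r 0 j = z (i :: r) 0 j.
    by move=> ji; rewrite !mxE inE (negPf ji).
  apply: le_trans (IHr I II) _.
  have [iI|iI] := boolP (i \in I).
    rewrite (@pder_ext _ _ _ _ (z r) (z (i :: r))) // => j jI.
    by apply: zE; apply: contraNneq jI => ->.
  rewrite (pder_update c iI zE) lerDl mulr_ge0 //.
    by rewrite !mxE inE eqxx /= subr_ge0; case: ifP.
  have II' : I0 \subset i |: I by rewrite (fintype.subset_trans II) ?finset.subsetU1.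
  exact: le_trans (pos _ II') (IHr _ II').
move=> I II; rewrite (_ : y = z (enum 'I_n)) ?zr //.
by apply/rowP => i; rewrite mxE mem_enum.
Qed.

(** The top derivatives are the positive constant c_d, and raising a coordinate
outside I transfers the positivity of the derivative in I + i to the one in
I. *)
Lemma pder_shift_gt0 I0 x e : 0 < e ->
  (forall I, I0 \subset I -> 0 <= pder c I x) -> poscone I0 (x + const_mx e).
Proof.
move=> e0 pos I; move: {2}(d - #|I|)%N (erefl (d - #|I|)%N) => r.
elim: r I => [|r IHr] I rI II Id.
  by rewrite pder_top //; nlia.
have [i iI] : exists i, i \notin I.
  apply/existsP; rewrite -negb_forall; apply/negP => /forallP h.
  have : #|I| = #|'I_n| by apply: eq_card => i; rewrite h inE.
  by rewrite card_ord; nlia.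
pose y : 'rV[R]_n := \row_j (x 0 j + (j != i)%:R * e).
have yE j : j != i -> y 0 j = (x + const_mx e) 0 j.
  by move=> ji; rewrite !mxE ji mul1r.
rewrite (pder_update c iI yE) !mxE eqxx mul0r addr0 [x 0 i + e]addrC addrK.
have II' : I0 \subset i |: I by rewrite (fintype.subset_trans II) ?finset.subsetU1.
apply: ltr_wpDl.
  apply: le_trans (pos I II) _; apply: pder_mono pos _ II => j.
  by rewrite mxE lerDl mulr_ge0 // ltW.
rewrite mulr_gt0 // (@pder_ext _ _ _ _ y (x + const_mx e)).
  by apply: IHr => //; rewrite cardsU1 iI; nlia.
by move=> j; rewrite !inE negb_or => /andP[ji _]; apply: yE.
Qed.

Lemma poscone_ray I0 : ray_test (poscone I0).
Proof.
move=> x P Ux P0 I II Id; apply: lt_le_trans (Ux I II Id) _.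
by apply: pder_mono (poscone_ge0 Ux) _ II => i; rewrite mxE lerDl P0.
Qed.

Lemma continuous_pder I : continuous (fun x => pder c I x).
Proof.
have cont (e : nat -> R) (s : seq 'I_n) :
    continuous (fun x : 'rV[R]_n => polar e [seq x 0 i | i <- s]).
  elim: s e => [|i s IHs] e x /=; first exact: cst_continuous.
  under eq_fun do rewrite polar_cons.
  exact: (cvgD (IHs e x) (cvgM (@coord_continuous _ _ _ 0 i x) (IHs (shiftc 1 e) x))).
have sE i : (i \in enum (~: I)) = (i \notin I) by rewrite mem_enum inE.
under eq_fun do rewrite (pder_polar _ _ (enum_uniq _) sE).
exact: cont.
Qed.

Lemma open_poscone I0 : open (poscone I0).
Proof.
rewrite openE => x Ux; rewrite /interior.
apply: (@filter_forall _ {set 'I_n} (fun I y => I0 \subset I -> (#|I| <= d)%N ->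
    0 < pder c I y) (nbhs x) _) => I.
have [II|/negP II] := boolP (I0 \subset I); last by near=> y.
have [Id|Id] := leqP #|I| d; last by near=> y => _; move: Id; rewrite ltnNge => /negP.
have near1 : \forall y \near x, 0 < pder c I y.
  exact: (@continuous_pder I x _ (lt_nbhsr (Ux I II Id))).
by near do move=> _ _.
Unshelve. all: by end_near.
Qed.

Lemma closure_poscone I0 x : closure (poscone I0) x ->
  forall I, I0 \subset I -> 0 <= pder c I x.
Proof.
move=> clx; apply: pder_ge0_all => I II Id.
rewrite leNgt; apply/negP => neg.
have /clx[y [Uy]] : \forall y \near x, pder c I y < 0.
  exact: (@continuous_pder I x _ (lt_nbhsl neg)).
by rewrite /= ltNge ltW // Uy.
Qed.

(** Induction on the size of I: by [pder_le0] a derivative of higher order cannot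
vanish before one of lower order does.  This makes the cone relatively closed in
the set where the derivative in I0 is positive. *)
Lemma poscone_boundary I0 x : (forall I, I0 \subset I -> 0 <= pder c I x) ->
  0 < pder c I0 x -> poscone I0 x.
Proof.
move=> pos pos0 I; move: {2}#|I| (leqnn #|I|) => r.
elim: r I => [|r IHr] I Ir II Id.
  have I00 : I = finset.set0 by apply/eqP; rewrite -cards_eq0; nlia.
  by move: II; rewrite I00 finset.subset0 => /eqP <-.
have [-> //|nI] := eqVneq I I0.
have [i iI iI0] : exists2 i, i \in I & i \notin I0.
  by apply/fintype.subsetPn; apply: contra nI => I'; rewrite finset.eqEsubset I' II.
rewrite lt_def pos // andbT; apply/negP => /eqP z.
have cI : #|I| = #|I :\ i|.+1 by rewrite (cardsD1 i) iI.
have IE : i |: I :\ i = I by rewrite finset.setD1K.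
have Id' : (#|I :\ i| < d)%N by rewrite -cI.
have iI' : i \notin I :\ i by rewrite !inE eqxx.
have := @pder_le0 (I :\ i) i x iI' Id'; rewrite IE => h.
have : 0 < pder c (I :\ i) x.
  apply: IHr; [nlia| |nlia].
  by rewrite finset.subsetD1 II.
rewrite ltNge h // => J IJ; apply: pos; exact: fintype.subset_trans IJ.
Qed.

(** Once the values of order above k are positive, the one of order k grows at
least linearly along the diagonal. *)
Lemma diagp_large k : (k <= d)%N ->
  exists t, forall j, (k <= j <= d)%N -> 0 < diagp c n j t.
Proof.
have cd' (i : nat) : (d < i <= n)%N -> c i = 0 by move=> /andP[/cd].
have ge0 t k1 : (forall j, (k1 <= j <= d)%N -> 0 < diagp c n j t) ->
    forall j, (k1 <= j <= n)%N -> 0 <= diagp c n j t.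
  move=> h j jn; have [jd|dj] := leqP j d; first by apply/ltW/h; nlia.
  by rewrite (diagp_eq0 _ cd') //; nlia.
move: {2}(d - k)%N (erefl (d - k)%N) => r.
elim: r k => [|r IHr] k rk kd.
  exists 0 => j jkd; have -> : j = d by nlia.
  rewrite /diagp polar_affine ?/shiftc ?addn0 => [|j1 j2]; last first.
    by rewrite /shiftc cd //; nlia.
  by rewrite (@cd (d + 1)%N) ?mul0r ?addr0 //; nlia.
have [t tpos] := IHr k.+1 ltac:(nlia) ltac:(nlia).
have q1 : 0 < diagp c n k.+1 t by apply: tpos; nlia.
pose t' := t + (`|diagp c n k t| + 1) / diagp c n k.+1 t.
have tt' : t <= t' by rewrite lerDl divr_ge0 // ?addr_ge0 // ltW.
exists t' => j jkd; have [->|jk] := eqVneq j k.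
  apply: lt_le_trans (diagp_growth tt' _ (ge0 _ _ tpos)); last nlia.
  rewrite /t' addrAC subrr add0r divfK ?gt_eqF //.
  have := ler_norm (- diagp c n k t); rewrite normrN; lra.
apply: lt_le_trans (tpos j _) _; first nlia.
apply: diagp_mono => //; first nlia.
by move=> i ijn; apply: (ge0 _ _ tpos); nlia.
Qed.

Lemma poscone_neq0 : exists t, poscone finset.set0 (const_mx t).
Proof.
have [t tpos] := diagp_large (leq0n d).
by exists t => I _ Id; rewrite pder_const tpos.
Qed.

Lemma segment_ray (B C : set 'rV[R]_n) x P : B `<=` C -> ray_test B -> B x ->
  orthant P -> connected_component C x (x + P).
Proof.
move=> BC rB Bx P0.
pose f (u : R) : 'rV[R]_n := x + u *: P.
have fc : continuous f.
  by move=> u; apply: cvgD; [exact: cvg_cst|apply: cvgZl; exact: cvg_id].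
exists (f @` `[0, 1]); last by exists 1; rewrite /f ?scale1r //= in_itv /= ler01 lexx.
split.
- by exists 0; rewrite /f ?scale0r ?addr0 //= in_itv /= ler01 lexx.
- move=> y [u]; rewrite /= in_itv /= => /andP[u0 _] <-.
  by apply/BC/rB => // i; rewrite mxE mulr_ge0.
- apply: connected_continuous_connected; first exact: segment_connected.
  exact: continuous_subspaceT.
Qed.

(** The cone is contained in the component, since any two of its points are
joined inside it through their coordinatewise maximum; and being open and
relatively closed in the set where h is positive, it contains the whole
component. *)
Lemma garding_cone_poscone (h : mpoly n R) I0 : (#|I0| <= d)%N ->
  (forall x, mpeval h x = pder c I0 x) -> garding_cone h = poscone I0.
Proof.
move=> I0d hE.
have [t Ut0] := poscone_neq0.
have Ut : poscone I0 (const_mx t) by apply: posconeS Ut0; exact: finset.sub0set.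
have Upos : poscone I0 `<=` pos_set h.
  by move=> x Ux; rewrite /pos_set /= hE; apply: Ux.
have comp : garding_component h (poscone I0); last first.
  apply/seteqP; split=> [x [U gU Ux]|x Ux]; last by exists (poscone I0).
  by rewrite -(garding_component_uniq gU comp).
split; last exact: poscone_ray.
exists (const_mx t); first exact: Upos.
apply/seteqP; split.
  move=> y Uy.
  have join (x z : 'rV[R]_n) : poscone I0 x ->
      connected_component (pos_set h) x (\row_i Num.max (x 0 i) (z 0 i)).
    move=> Ux; set w := \row_i _; rewrite (_ : w = x + (w - x)); last first.
      by rewrite addrC subrK.
    apply: (segment_ray Upos (@poscone_ray I0) Ux) => i.
    by rewrite !mxE subr_ge0 le_max lexx.
  have := join _ y Ut.
  rewrite (_ : \row_i _ = \row_i Num.max (y 0 i) ((const_mx t : 'rV_n) 0 i)).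
    move/same_connected_component ->.
    apply: connected_component_sym; exact: join.
  by apply/rowP => i; rewrite !mxE maxC.
set A := connected_component _ _.
have A0 : A (const_mx t).
  by apply: connected_component_refl; apply: Upos.
have -> : A = A `&` poscone I0; last exact: subIsetr.
apply/esym; apply: (component_connected (A := pos_set h) (x := const_mx t)).
- by exists (const_mx t).
- by exists (poscone I0) => //; exact: open_poscone.
- exists (closure (poscone I0)); first exact: closed_closure.
  apply/seteqP; split=> x [Ax Ux]; split=> //; first exact: subset_closure.
  apply: poscone_boundary; first exact: closure_poscone.
  by rewrite -hE; apply: (connected_component_sub Ax).
Qed.

End Cones.

(** * Polarization of a univariate polynomial *)

Section SubsetSums.
Context {A : comNzRingType} {n : nat}.

(** The monomial expansion, obtained by distributing the product of the linear
factors. *)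
Lemma pder_sum (c : nat -> A) (I : {set 'I_n}) (x : 'rV[A]_n) :
  pder c I x = \sum_(J : {set 'I_n} | [disjoint J & I])
    c (#|I| + #|J|)%N * \prod_(j in J) x 0 j.
Proof.
rewrite /pder big_mkcond /=.
under eq_bigr => i _.
  rewrite addrC (_ : (if _ then _ else _) =
    (if i \in I then 0 else (x 0 i)%:P * 'X) + 1); first over.
  by rewrite inE; case: (i \in I) => /=; rewrite ?add0r // addrC.
rewrite bigA_distr umbral_sum [RHS]big_mkcond; apply: eq_bigr => J _.
case: ifPn => [JI|].
  rewrite -big_mkcond /= (_ : \prod_(i in J) _ =
      (\prod_(i in J) x 0 i)%:P * 'X^#|J|).
    by rewrite mul_polyC umbralZ umbralXn mulrC.
  rewrite rmorph_prod -prodr_const -big_split /=; apply: eq_bigr => i iJ.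
  by rewrite (disjointFr JI iJ).
move=> /pred0Pn[i /andP[/= iJ iI]].
by rewrite (bigD1 i) //= iJ iI mul0r umbral0.
Qed.

Lemma umbral_linX (c : nat -> A) (t : A) r :
  umbral c ((1 + t%:P * 'X) ^+ r) = \sum_(j < r.+1) c j * (t ^+ j *+ 'C(r, j)).
Proof.
rewrite exprDn umbral_sum; apply: eq_bigr => j _.
rewrite expr1n mul1r exprMn -rmorphXn -mulrnAl -polyCMn mul_polyC umbralZ.
by rewrite umbralXn mulrC.
Qed.

End SubsetSums.

Lemma subm_self n (m : multinom n) : mnm_sub m m = mnm0.
Proof. by apply/mnmP => i; rewrite mnmBE subnn mnm0E. Qed.

Section Polarization.
Context {R : realType}.
Implicit Types (p : {poly R}) (n d k : nat) (t : R).

Definition pcoef n p : nat -> R := fun j => p`_j / 'C(n, j)%:R.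

Lemma mpeval_mesym n j (x : 'rV[R]_n) : mpeval (mesym n R j) x =
  \sum_(J : {set 'I_n} | #|J| == j) \prod_(i in J) x 0 i.
Proof.
rewrite /mpeval /mesym rmorph_sum; apply: eq_bigr => J _.
by rewrite rmorph_prod; apply: eq_bigr => i _; rewrite /= mevalXU.
Qed.

Lemma polarization_sum n p : (size p <= n.+1)%N -> polarization n p =
  \sum_(J : {set 'I_n}) pcoef n p #|J| *: \prod_(i in J) mpolyX R (mnm1 i).
Proof.
move=> pn; rewrite /polarization.
rewrite (big_ord_widen _ (fun j => (p`_j / 'C(n, j)%:R) *: mesym n R j) pn).
rewrite big_mkcond /= (eq_bigr (fun j : 'I_n.+1 =>
    \sum_(J : {set 'I_n} | #|J| == j) pcoef n p #|J| *: \prod_(i in J) mpolyX R (mnm1 i))).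
  rewrite (exchange_big_dep predT) //=; apply: eq_bigr => J _.
  have Jn : (#|J| < n.+1)%N by rewrite ltnS -[leqRHS]card_ord max_card.
  by rewrite (big_pred1 (Ordinal Jn)) // => j; rewrite eq_sym -val_eqE.
move=> j _; case: ltnP => jp.
  rewrite /mesym scaler_sumr; apply: eq_bigr => J /eqP cJ.
  by rewrite /pcoef cJ.
by rewrite big1 // => J /eqP cJ; rewrite /pcoef cJ nth_default // mul0r scale0r.
Qed.

Lemma mpeval_polarization n p (x : 'rV[R]_n) : (size p <= n.+1)%N ->
  mpeval (polarization n p) x = pder (pcoef n p) finset.set0 x.
Proof.
move=> pn; rewrite polarization_sum // pder_sum /mpeval rmorph_sum.
apply: eq_big => [J|J _]; first by rewrite -setI_eq0 finset.setI0 eqxx.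
rewrite /= mevalZ rmorph_prod cards0 add0n; congr (_ * _).
by apply: eq_bigr => i _; rewrite /= mevalXU.
Qed.

Lemma mpeval_mderiv_prod n (i : 'I_n) (J : {set 'I_n}) (x : 'rV[R]_n) :
  mpeval (mderiv i (\prod_(j in J) mpolyX R (mnm1 j))) x =
  if i \in J then \prod_(j in J :\ i) x 0 j else 0.
Proof.
have notin (K : {set 'I_n}) : i \notin K ->
    mderiv i (\prod_(j in K) mpolyX R (mnm1 j)) = 0.
  move=> iK; apply: (big_ind (fun q => mderiv i q = 0)).
  - by rewrite -mpolyC1 mderivC.
  - by move=> q r q0 r0; rewrite mderivM q0 r0 mul0r mulr0 addr0.
  - move=> j jK; rewrite mderivX mnm1E (_ : j == i = false) ?scale0r //.
    by apply: contraNF iK => /eqP <-.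
case: ifPn => iJ; last by rewrite notin // /mpeval rmorph0.
rewrite (big_setD1 i) //= mderivM notin ?inE ?eqxx // mulr0 addr0.
rewrite mderivX mnm1E eqxx scale1r subm_self mpolyX0 mul1r /mpeval rmorph_prod.
by apply: eq_bigr => j _; rewrite /= mevalXU.
Qed.

Lemma mpeval_mderiv_polarization n p i (x : 'rV[R]_n) : (size p <= n.+1)%N ->
  mpeval (mderiv i (polarization n p)) x = pder (pcoef n p) [set i]%SET x.
Proof.
move=> pn; rewrite polarization_sum // linear_sum pder_sum /mpeval rmorph_sum.
rewrite (bigID (fun J : {set 'I_n} => i \in J)) /= [X in _ + X]big1 ?addr0; last first.
  move=> J /negPf iJ; rewrite linearZ /= mevalZ.
  by have := mpeval_mderiv_prod i J x; rewrite /mpeval iJ => ->; rewrite mulr0.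
rewrite (reindex_onto (fun J => i |: J) (fun J => J :\ i)) /=; last first.
  by move=> J; exact: finset.setD1K.
apply: eq_big => [J|J].
  rewrite finset.setU11 /= -setI_eq0.
  apply/eqP/eqP => [<-|].
    by apply/finset.setP => j; rewrite !inE; case: (j == i); rewrite ?andbF.
  move/finset.setP => Ji; apply: finset.setU1K.
  by have := Ji i; rewrite !inE eqxx andbT => ->.
rewrite finset.setU11 /= => /eqP iJ; rewrite linearZ /= mevalZ.
have := mpeval_mderiv_prod i (i |: J) x; rewrite /mpeval finset.setU11 => ->.
rewrite iJ cards1 cardsU1 (_ : i \notin J) //.
by rewrite -iJ !inE eqxx.
Qed.

(** The coefficients agree because
(k + j)^_k C(n, k + j) = n^_k C(n - k, j). *)
Lemma diagp_derivn n p k t : (size p <= n.+1)%N -> (k <= n)%N ->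
  (p^`(k)).[t] = (n ^_ k)%:R * diagp (pcoef n p) n k t.
Proof.
move=> pn kn; rewrite /diagp /polar.
rewrite (_ : \prod_(y <- _) _ = (1 + t%:P * 'X) ^+ (n - k)); last first.
  elim: (n - k)%N => [|r IHr]; first by rewrite big_nil.
  by rewrite /= big_cons IHr exprS.
rewrite umbral_linX (@horner_coef_wide _ (n - k).+1); last first.
  apply/leq_sizeP => j jk; rewrite coef_derivn nth_default ?mul0rn // (leq_trans pn) //; lia.
rewrite mulr_sumr; apply: eq_bigr => j _.
rewrite coef_derivn /shiftc /pcoef.
have jn : (k + j <= n)%N by have := ltn_ord j; lia.
have C0 : ('C(n, k + j)%:R != 0 :> R) by rewrite pnatr_eq0 -lt0n bin_gt0.
have key : ((k + j) ^_ k * 'C(n, k + j) = n ^_ k * 'C(n - k, j))%N.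
  apply/eqP; rewrite -(eqn_pmul2r (fact_gt0 j)) -!mulnA bin_ffact.
  rewrite [('C(_, _) * _)%N]mulnC mulnA.
  have -> : ((k + j) ^_ k * j`! = (k + j)`!)%N.
    by have := ffact_fact (leq_addr j k); rewrite addKn.
  rewrite mulnC bin_ffact; apply/eqP; elim: (nat_of_ord j) => [|l IHl]; first by rewrite addn0 muln1.
  by rewrite addnS !ffactnSr IHl subnDA mulnA.
rewrite -[_ *+ (_ ^_ _)]mulr_natr -[t ^+ j *+ _]mulr_natr.
transitivity (p`_(k + j) / 'C(n, k + j)%:R * t ^+ j * (n ^_ k * 'C(n - k, j))%:R);
  last by rewrite natrM; ring.
by rewrite -key natrM; field.
Qed.

Lemma mpeval_mpoly_of_poly p (x : 'rV[R]_1) :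
  mpeval (mpoly_of_poly p) x = p.[x 0 0].
Proof.
rewrite /mpeval /mpoly_of_poly rmorph_sum horner_coef; apply: eq_bigr => j _.
by rewrite /= mevalZ rmorphXn /= mevalXU.
Qed.

Lemma dirderiv_mpoly_of_poly p :
  dirderiv (const_mx 1) (mpoly_of_poly p) = mpoly_of_poly p^`().
Proof.
have derX j : mderiv ord0 (mpolyX R (mnm1 (ord0 : 'I_1)) ^+ j)
    = mpolyX R (mnm1 ord0) ^+ j.-1 *+ j.
  elim: j => [|j IHj]; first by rewrite expr0 -mpolyC1 mderivC mulr0n.
  rewrite exprS mderivM IHj mderivX mnm1E eqxx scale1r subm_self mpolyX0 mul1r.
  case: j {IHj} => [|j]; first by rewrite mulr0n mulr0 addr0.
  by rewrite mulrnAr -exprS [in RHS]mulrS.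
rewrite /dirderiv big_ord1 mxE scale1r /mpoly_of_poly linear_sum.
have -> : \sum_(j < size p^`()) p^`()`_j *: mpolyX R (mnm1 ord0) ^+ j =
    \sum_(j < (size p).-1) p^`()`_j *: mpolyX R (mnm1 (ord0 : 'I_1)) ^+ j.
  have h : (size p^`() <= (size p).-1)%N.
    apply/leq_sizeP => j; rewrite -subn1 leq_subLR add1n => jp.
    by rewrite coef_deriv nth_default ?mul0rn.
  rewrite (big_ord_widen _ (fun j => p^`()`_j *: mpolyX R (mnm1 (ord0 : 'I_1)) ^+ j) h).
  rewrite big_mkcond; apply: eq_bigr => j _; case: ltnP => // jp.
  by rewrite nth_default // scale0r.
case: (size p) => [|s]; first by rewrite !big_ord0.
rewrite big_ord_recl /= linearZ /= derX mulr0n scaler0 add0r.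
apply: eq_bigr => j _; rewrite linearZ /= derX /bump leq0n add1n coef_deriv.
by rewrite -scalerMnr scalerMnl.
Qed.

End Polarization.

(** * Nesting of the derivatives of a Garding polynomial *)

Section GardingPolynomial.
Context {R : realType}.
Implicit Types (p : {poly R}) (n d k : nat) (t : R).

Lemma mpoly_of_poly_eq0 p : (mpoly_of_poly p == 0) = (p == 0).
Proof.
apply/eqP/eqP => [p0|->]; last by rewrite /mpoly_of_poly size_poly0 big_ord0.
apply/eqP; apply: contraT => nz.
have roots0 : all (root p) [seq i%:R | i <- iota 0 (size p)].
  apply/allP => _ /mapP[i _ ->]; rewrite rootE.
  have := mpeval_mpoly_of_poly p (const_mx i%:R).
  by rewrite p0 /mpeval meval0 mxE => <-.
have := max_poly_roots nz roots0.
rewrite size_map size_iota ltnn => ->//.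
by rewrite map_inj_uniq ?iota_uniq //; exact: mulrIn.
Qed.

(** For one variable the derivative in direction 1 is the usual one, so a single
step of the recursion yields the inclusion of the components. *)
Lemma garding_deriv p : garding (mpoly_of_poly p) -> p^`() != 0 ->
  garding (mpoly_of_poly p^`()) /\
  garding_cone (mpoly_of_poly p) `<=` garding_cone (mpoly_of_poly p^`()).
Proof.
move=> [_ _ gd cd] p'0.
have dp : dirderiv (const_mx 1) (mpoly_of_poly p) != 0.
  by rewrite dirderiv_mpoly_of_poly mpoly_of_poly_eq0.
have P0 : orthant (const_mx 1 : 'rV[R]_1) by move=> i; rewrite mxE.
have m1 : (1 < msize (mpoly_of_poly p))%N.
  rewrite ltnNge; apply: contra dp => /msize1_polyC ->.
  by rewrite /dirderiv big1 // => i _; rewrite mderivC scaler0.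
have := gd m1 _ P0 dp; have := cd m1 _ P0 dp.
by rewrite dirderiv_mpoly_of_poly.
Qed.

Lemma derivn_neq0 p k : (k < size p)%N -> p^`(k) != 0.
Proof.
move=> kp; apply/eqP => /(congr1 (fun q : {poly R} => q`_((size p).-1 - k))) /eqP.
have p0 : p != 0 by rewrite -size_poly_gt0 (leq_trans _ kp).
have kp1 : (k <= (size p).-1)%N by rewrite -ltnS prednK // size_poly_gt0.
rewrite coef0 coef_derivn subnKC // mulrn_eq0 -lead_coefE lead_coef_eq0.
by rewrite (negPf p0) orbF eqn0Ngt ffact_gt0 kp1.
Qed.

Lemma garding_derivn p k : (k < size p)%N -> garding (mpoly_of_poly p) ->
  garding (mpoly_of_poly p^`(k)).
Proof.
elim: k => [//|k IHk] kp gp.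
rewrite derivnS; apply: (garding_deriv _ _).1; first by apply: IHk => //; lia.
by rewrite -derivnS derivn_neq0.
Qed.

(** If the k-th derivative were positive at t, it would be positive on the whole
half line from t, so that t would lie in its component and hence in that of the
next derivative, which vanishes at t. *)
Lemma garding_nested p n d : (d <= n)%N -> size p = d.+1 ->
  garding (mpoly_of_poly p) -> forall y0, nested (pcoef n p) n d y0.
Proof.
move=> dn szp gp y0 t k _ kd q0 q1; rewrite leNgt; apply/negP => qk.
have szn : (size p <= n.+1)%N by rewrite szp.
have ff j : (j <= n)%N -> 0 < (n ^_ j)%:R :> R by move=> jn; rewrite ltr0n ffact_gt0.
have gk : garding (mpoly_of_poly p^`(k)) by apply: garding_derivn; rewrite ?szp //; lia.
have p'0 : p^`(k)^`() != 0.
  by rewrite -derivnS derivn_neq0 // szp.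
have [_ sub] := garding_deriv gk p'0.
have [_ [U gU] _ _] := gk.
pose B : set 'rV[R]_1 := [set x | t <= x 0 0].
have Bpos : B `<=` pos_set (mpoly_of_poly p^`(k)).
  move=> x tx; rewrite /pos_set /= mpeval_mpoly_of_poly (@diagp_derivn _ n) //; last lia.
  rewrite mulr_gt0 ?ff //; first lia.
  by apply: lt_le_trans qk _; apply: diagp_mono => //; lia.
have Bray : ray_test B.
  by move=> x P Bx P0; rewrite /B /= mxE; apply: le_trans Bx _; rewrite lerDl.
have Bt : B (const_mx t) by rewrite /B /= mxE.
have /sub [U' gU' U't] : garding_cone (mpoly_of_poly p^`(k)) (const_mx t).
  exists U => //; have [[x posx UE] rU] := gU.
  pose z : 'rV[R]_1 := const_mx (Num.max t (x 0 0)).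
  have Uz : U z.
    rewrite (_ : z = x + (z - x)); last by rewrite addrC subrK.
    apply: rU; first by rewrite UE; exact: connected_component_refl.
    by move=> i; rewrite !mxE (ord1 i) subr_ge0 le_max lexx orbT.
  have tz : connected_component (pos_set (mpoly_of_poly p^`(k))) (const_mx t) z.
    rewrite (_ : z = const_mx t + (z - const_mx t)); last by rewrite addrC subrK.
    apply: (segment_ray Bpos Bray Bt) => i.
    by rewrite !mxE subr_ge0 le_max lexx.
  rewrite UE in Uz *; apply: connected_component_trans Uz _.
  exact: connected_component_sym.
have [[x _ U'E] _] := gU'.
have : pos_set (mpoly_of_poly p^`(k)^`()) (const_mx t).
  by rewrite U'E in U't; exact: connected_component_sub U't.
rewrite /pos_set /= mpeval_mpoly_of_poly mxE -derivnS (@diagp_derivn _ n) //; last lia.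
by rewrite q1 mulr0 ltxx.
Qed.

End GardingPolynomial.

(** * Expansion in principal minors *)

Section PrincipalMinors.
Context {A : comNzRingType} {n : nat}.
Implicit Types (K : {set 'I_n}) (P : 'M[A]_n) (x : 'rV[A]_n) (c : nat -> A).

(** Completing the principal submatrix by the identity keeps the size of the
matrix independent of K without changing the minor. *)
Definition pminor K P : 'M[A]_n :=
  \matrix_(i, j) if (i \in K) && (j \in K) then P i j else (i == j)%:R.

(** In the Leibniz formula, choose for each row i either the diagonal term, for i
outside K, or the entry of P; a permutation contributes only if it fixes all i
outside K, so that it permutes K. *)
Lemma det_diag_add x P : \det (diag_mx x + P) =
  \sum_(K : {set 'I_n}) (\prod_(i in ~: K) x 0 i) * \det (pminor K P).
Proof.
pose T (K : {set 'I_n}) (s : 'S_n) :=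
  \prod_(i < n) (if i \in K then P i (s i) else x 0 i *+ (i == s i)).
transitivity (\sum_(s : 'S_n) \sum_(K : {set 'I_n}) (-1) ^+ s * T K s).
  apply: eq_bigr => s _; rewrite -mulr_sumr; congr (_ * _).
  rewrite -bigA_distr; apply: eq_bigr => i _.
  by rewrite !mxE addrC.
rewrite exchange_big; apply: eq_bigr => K _ /=.
rewrite /determinant mulr_sumr; apply: eq_bigr => s _.
rewrite mulrCA; congr (_ * _); rewrite /T.
have [/forallP fixK|] := boolP [forall i : 'I_n, (i \notin K) ==> (s i == i)].
  rewrite (bigID (mem (~: K))) /= [X in _ = _ * X](bigID (mem (~: K))) /=.
  rewrite [X in _ = _ * (X * _)]big1 ?mul1r => [|i]; last first.
    rewrite inE => iK; have := fixK i; rewrite iK /= => /eqP si.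
    by rewrite mxE (negPf iK) /= si eqxx.
  congr (_ * _); apply: eq_bigr => i; rewrite inE.
    by move=> iK; have := fixK i; rewrite (negPf iK) /= => /eqP ->; rewrite eqxx.
  rewrite negbK => iK; rewrite mxE iK /= ifT //.
  have [//|siK] := boolP (s i \in K).
  have := fixK (s i); rewrite siK /= => /eqP /perm_inj si.
  by rewrite si iK in siK.
rewrite negb_forall => /existsP; case=> i; rewrite negb_imply => /andP[iK si].
rewrite (bigD1 i) //= (negPf iK) [i == _]eq_sym (negPf si) mulr0n mul0r.
by rewrite [X in _ * X](bigD1 i) //= mxE (negPf iK) /= eq_sym (negPf si) mul0r mulr0.
Qed.

Lemma pminor_scale K (a : A) P :
  pminor K (a *: P) = diag_mx (\row_i if i \in K then a else 1) *m pminor K P.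
Proof.
apply/matrixP => i j; rewrite mul_diag_mx !mxE.
case: (boolP (i \in K)) => iK /=; last by rewrite mul1r.
case: (boolP (j \in K)) => jK //=.
have /negPf -> : i != j by apply: contraNneq jK => <-.
by rewrite mulr0.
Qed.

Lemma det_pminor_scale K (a : A) P : \det (pminor K (a *: P)) = a ^+ #|K| * \det (pminor K P).
Proof.
rewrite pminor_scale det_mulmx det_diag; congr (_ * _).
rewrite -prodr_const [RHS]big_mkcond; apply: eq_bigr => i _.
by rewrite mxE.
Qed.

Lemma pminor0 P : pminor finset.set0 P = 1%:M.
Proof. by apply/matrixP => i j; rewrite !mxE inE. Qed.

End PrincipalMinors.

Lemma map_pminor (A B : comNzRingType) (f : {rmorphism A -> B}) n
    (K : {set 'I_n}) (P : 'M[A]_n) :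
  map_mx f (pminor K P) = pminor K (map_mx f P).
Proof.
apply/matrixP => i j; rewrite !mxE; case: ifP => _ //.
by rewrite rmorph_nat.
Qed.

Lemma rmorph_pder (A B : comNzRingType) (f : {rmorphism A -> B}) n (c : nat -> A)
    (I : {set 'I_n}) (x : 'rV[A]_n) :
  f (pder c I x) = pder (f \o c) I (map_mx f x).
Proof.
rewrite !pder_sum rmorph_sum; apply: eq_bigr => J _.
rewrite rmorphM rmorph_prod; congr (_ * _).
by apply: eq_bigr => i _; rewrite mxE.
Qed.

Section SpectralFunction.
Context {A : comNzRingType} {n : nat}.
Implicit Types (K : {set 'I_n}) (P N : 'M[A]_n) (x : 'rV[A]_n) (c : nat -> A).

(** On a matrix with eigenvalues x this is sum_j c_j sigma_j(x), as
det(1 + X N) is the product of the 1 + x_i X. *)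
Definition specfun c N : A :=
  umbral c (\det (1%:M + 'X *: map_mx polyC N)).

Lemma specfun_expand c x P : specfun c (diag_mx x + P) =
  \sum_(K : {set 'I_n}) \det (pminor K P) * pder c K x.
Proof.
rewrite /specfun.
have -> : 1%:M + 'X *: map_mx polyC (diag_mx x + P) =
    diag_mx (\row_i (1 + (x 0 i)%:P * 'X)) + 'X *: map_mx polyC P.
  rewrite map_mxD scalerDr addrA; congr (_ + _).
  apply/matrixP => i j; rewrite !mxE; case: (eqVneq i j) => [->|ij].
    by rewrite !mulr1n mulrC.
  by rewrite !mulr0n mulr0 addr0.
rewrite det_diag_add umbral_sum; apply: eq_bigr => K _.
rewrite det_pminor_scale -map_pminor det_map_mx mulrCA umbralMXn.
rewrite mulrC mul_polyC umbralZ /pder.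
by congr (_ * umbral _ _); apply: eq_bigr => i _; rewrite mxE.
Qed.

Lemma specfun_diag c x : specfun c (diag_mx x) = pder c finset.set0 x.
Proof.
rewrite -[diag_mx x]addr0 specfun_expand (bigD1 finset.set0) //=.
rewrite pminor0 det1 mul1r big1 ?addr0 // => K /finset.set0Pn; case=> i iK.
have -> : (0 : 'M[A]_n) = 0 *: 0 by rewrite scaler0.
have K0 : (#|K| == 0%N) = false.
  by rewrite cards_eq0; apply/negbTE/finset.set0Pn; exists i.
by rewrite det_pminor_scale expr0n K0 !mul0r.
Qed.

Lemma specfun_conj c Q Q' N : Q' *m Q = 1%:M ->
  specfun c (Q' *m N *m Q) = specfun c N.
Proof.
move=> QQ; rewrite /specfun; congr umbral.
have QQp : map_mx polyC Q' *m map_mx polyC Q = 1%:M.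
  by rewrite -map_mxM QQ map_mx1.
rewrite (_ : _ + _ = map_mx polyC Q' *m (1%:M + 'X *: map_mx polyC N) *m map_mx polyC Q).
  by rewrite !det_mulmx mulrAC -det_mulmx QQp det1 mul1r.
rewrite mulmxDr mulmxDl mulmx1 QQp; congr (_ + _).
by rewrite -scalemxAr -scalemxAl !map_mxM.
Qed.

End SpectralFunction.

(** * Positive semidefinite matrices *)

Section Semidefinite.
Local Open Scope sesquilinear_scope.
Context {C : numClosedFieldType}.

Definition qform n (N : 'M[C]_n) (v : 'rV[C]_n) : C := (v *m N *m v ^t*) 0 0.

Definition psdmx n (N : 'M[C]_n) : Prop :=
  N ^t* = N /\ forall v, 0 <= qform N v.

Lemma adjM m n p (A : 'M[C]_(m, n)) (B : 'M[C]_(n, p)) :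
  (A *m B) ^t* = B ^t* *m A ^t*.
Proof. by rewrite trmx_mul map_mxM. Qed.

Lemma adjK m n (A : 'M[C]_(m, n)) : A ^t* ^t* = A.
Proof. exact: trmxCK. Qed.

Lemma qform_conj m n (Q : 'M[C]_(m, n)) N v :
  qform (Q *m N *m Q ^t*) v = qform N (v *m Q).
Proof. by rewrite /qform adjM !mulmxA. Qed.

Lemma qform_row m n (Q : 'M[C]_(m, n)) N i :
  (Q *m N *m Q ^t*) i i = qform N (row i Q).
Proof.
rewrite /qform -row_mul !mxE; apply: eq_bigr => k _.
by rewrite !mxE.
Qed.

Lemma qformD n (N P : 'M[C]_n) v : qform (N + P) v = qform N v + qform P v.
Proof. by rewrite /qform mulmxDr mulmxDl mxE. Qed.

Lemma qform_diag n (x v : 'rV[C]_n) :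
  qform (diag_mx x) v = \sum_i x 0 i * `|v 0 i| ^+ 2.
Proof.
rewrite /qform mxE; apply: eq_bigr => i _.
by rewrite mul_mx_diag !mxE normCK mulrCA mulrA.
Qed.

Lemma psdmxD n (N P : 'M[C]_n) : psdmx N -> psdmx P -> psdmx (N + P).
Proof.
move=> [hN pN] [hP pP]; split=> [|v]; first by rewrite linearD /= map_mxD hN hP.
by rewrite qformD addr_ge0.
Qed.

Lemma psdmx_conj m n (Q : 'M[C]_(m, n)) N : psdmx N -> psdmx (Q *m N *m Q ^t*).
Proof.
move=> [hN pN]; split=> [|v]; first by rewrite !adjM adjK hN mulmxA.
by rewrite qform_conj.
Qed.

Lemma psdmx_diag n (x : 'rV[C]_n) : (forall i, 0 <= x 0 i) -> psdmx (diag_mx x).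
Proof.
move=> x0; split=> [|v].
  rewrite tr_diag_mx map_diag_mx; congr diag_mx; apply/rowP => i.
  by rewrite mxE /= geC0_conj.
by rewrite qform_diag sumr_ge0 // => i _; rewrite mulr_ge0 ?exprn_ge0.
Qed.

Lemma hermitian_spectral n (N : 'M[C]_n) : N ^t* = N ->
  exists Q : 'M[C]_n, exists x : 'rV[C]_n,
    [/\ Q *m Q ^t* = 1%:M, Q ^t* *m Q = 1%:M & N = Q ^t* *m diag_mx x *m Q].
Proof.
move=> hN; have /orthomx_spectralP NE : N \is normalmx.
  by apply/normalmxP; rewrite hN.
have Qu := spectral_unitarymx N.
exists (spectralmx N), (spectral_diag N); rewrite -invmx_unitary //.
by rewrite mulmxV ?mulVmx ?unitarymx_unit.
Qed.

Lemma spectral_entry n (N Q : 'M[C]_n) x i : Q *m Q ^t* = 1%:M ->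
  N = Q ^t* *m diag_mx x *m Q -> x 0 i = qform N (row i Q).
Proof.
move=> QQ ->; rewrite -qform_row !mulmxA QQ mul1mx -mulmxA QQ mulmx1.
by rewrite mxE eqxx mulr1n.
Qed.

Lemma psdmx_spectral n (N : 'M[C]_n) : psdmx N ->
  exists Q : 'M[C]_n, exists x : 'rV[C]_n,
    [/\ Q *m Q ^t* = 1%:M, Q ^t* *m Q = 1%:M, N = Q ^t* *m diag_mx x *m Q &
      forall i, 0 <= x 0 i].
Proof.
move=> [hN pN]; have [Q [x [QQ QQ' NE]]] := hermitian_spectral hN.
by exists Q, x; split=> // i; rewrite (spectral_entry i QQ NE).
Qed.

Lemma psdmx_det_ge0 n (N : 'M[C]_n) : psdmx N -> 0 <= \det N.
Proof.
move=> /psdmx_spectral[Q [x [QQ QQ' -> x0]]].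
rewrite !det_mulmx mulrAC -det_mulmx QQ' det1 mul1r det_diag.
by rewrite prodr_ge0.
Qed.

Definition indic n (K : {set 'I_n}) : 'M[C]_n := diag_mx (\row_i (i \in K)%:R).

Lemma indic_adj n (K : {set 'I_n}) : (indic K) ^t* = indic K.
Proof.
by rewrite tr_diag_mx map_diag_mx; congr diag_mx; apply/rowP=> i; rewrite !mxE rmorph_nat.
Qed.

Lemma psdmx_indic n (K : {set 'I_n}) : psdmx (indic K).
Proof. by apply: psdmx_diag => i; rewrite mxE ler0n. Qed.

Lemma compressE n (K : {set 'I_n}) (N : 'M[C]_n) i j :
  (indic K *m N *m (indic K) ^t*) i j = if (i \in K) && (j \in K) then N i j else 0.
Proof.
rewrite indic_adj /indic mul_mx_diag mul_diag_mx !mxE.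
by case: (i \in K); case: (j \in K); rewrite ?mul1r ?mulr1 ?mul0r ?mulr0.
Qed.

(** The sum of a compression of N and a coordinate projection. *)
Lemma psdmx_pminor n (K : {set 'I_n}) (N : 'M[C]_n) : psdmx N -> psdmx (pminor K N).
Proof.
move=> pN.
have -> : pminor K N = indic K *m N *m (indic K) ^t* + indic (~: K).
  apply/matrixP => i j; rewrite [RHS]mxE compressE !mxE inE.
  case: (boolP (i \in K)) => iK /=; last by rewrite add0r.
  case: (boolP (j \in K)) => jK /=; first by rewrite mul0rn addr0.
  have /negPf -> : i != j by apply: contraNneq jK => <-.
  by rewrite mulr0n addr0.
by apply: psdmxD; [exact: psdmx_conj|exact: psdmx_indic].
Qed.

(** These coefficients are mixed discriminants of P and E.  In a basis that
diagonalizes P they are combinations, with products of eigenvalues of P as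
weights, of principal minors of the matrix of E. *)
Lemma psdmx_det_coef_ge0 n (P E : 'M[C]_n) k : psdmx P -> psdmx E ->
  0 <= (\det (map_mx polyC P + 'X *: map_mx polyC E))`_k.
Proof.
move=> /psdmx_spectral[Q [x [QQ QQ' PE x0]]] pE.
pose E' := Q *m E *m Q ^t*; have pE' : psdmx E' by exact: psdmx_conj.
have -> : map_mx polyC P + 'X *: map_mx polyC E =
    map_mx polyC (Q ^t*) *m (diag_mx (map_mx polyC x) + 'X *: map_mx polyC E')
    *m map_mx polyC Q.
  rewrite mulmxDr mulmxDl -map_diag_mx -!map_mxM -PE; congr (_ + _).
  rewrite -scalemxAr -scalemxAl -!map_mxM /E' !mulmxA QQ' mul1mx -mulmxA QQ'.
  by rewrite mulmx1.
rewrite !det_mulmx mulrAC -det_mulmx -map_mxM QQ' map_mx1 det1 mul1r.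
rewrite det_diag_add coef_sum sumr_ge0 // => J _.
rewrite det_pminor_scale -map_pminor det_map_mx.
under eq_bigr do rewrite mxE.
rewrite -rmorph_prod coefCM mulr_ge0 ?prodr_ge0 //.
rewrite coefXnM; case: ifP => // _; rewrite coefC; case: ifP => // _.
exact/psdmx_det_ge0/psdmx_pminor.
Qed.

Lemma diag_expansion n (c : nat -> C) (x y : 'rV[C]_n) (P W : 'M[C]_n) :
  W ^t* *m W = 1%:M -> diag_mx x + P = W ^t* *m diag_mx y *m W ->
  pder c finset.set0 y = \sum_(K : {set 'I_n}) \det (pminor K P) * pder c K x.
Proof.
by move=> WW E; rewrite -specfun_expand E specfun_conj // specfun_diag.
Qed.

(** The expansion at the zero matrix, for the sequence c that is 1 at k and 0
elsewhere. *)
Lemma esym_pminor n k (x : 'rV[C]_n) (P W : 'M[C]_n) :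
  W ^t* *m W = 1%:M -> P = W ^t* *m diag_mx x *m W ->
  \sum_(K : {set 'I_n} | #|K| == k) \prod_(i in K) x 0 i =
  \sum_(K : {set 'I_n} | #|K| == k) \det (pminor K P).
Proof.
move=> WW PE; pose c j : C := (j == k)%:R.
have E : diag_mx (0 : 'rV[C]_n) + P = W ^t* *m diag_mx x *m W.
  by rewrite -PE (_ : diag_mx 0 = 0) ?add0r // linear0.
have := diag_expansion c WW E; rewrite pder_sum.
rewrite (eq_bigl predT) => [|J]; last first.
  by rewrite -setI_eq0 finset.setI0 eqxx.
rewrite cards0 [in LHS]big_mkcond [in RHS]big_mkcond /= => h.
transitivity (\sum_(J : {set 'I_n}) c (0 + #|J|)%N * \prod_(j in J) x 0 j).
  rewrite big_mkcond; apply: eq_bigr => J _; rewrite add0n /c.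
  by case: eqP; rewrite ?mul1r ?mul0r.
rewrite h [RHS]big_mkcond; apply: eq_bigr => K _.
rewrite pder_sum (bigD1 finset.set0) /=; last first.
  by rewrite -setI_eq0 finset.set0I eqxx.
rewrite big_set0 mulr1 cards0 addn0 big1 ?addr0 => [|J /andP[_ J0]].
  by rewrite /c; case: eqP; rewrite ?mulr1 ?mulr0.
have /finset.set0Pn : J != finset.set0 by [].
by case=> i iJ; rewrite (bigD1 i) //= mxE mul0r mulr0.
Qed.

(** In the expansion of the increment of f all terms are nonnegative, and
those with d elements in K add up to the lower bound. *)
Lemma spectral_gain n (c : nat -> C) d (x y : 'rV[C]_n) (P W : 'M[C]_n) :
  (0 < d)%N -> psdmx P -> (forall K : {set 'I_n}, #|K| = d -> pder c K x = c d) ->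
  (forall K : {set 'I_n}, K != finset.set0 -> 0 <= pder c K x) ->
  W ^t* *m W = 1%:M -> diag_mx x + P = W ^t* *m diag_mx y *m W ->
  c d * \sum_(K : {set 'I_n} | #|K| == d) \det (pminor K P)
  <= pder c finset.set0 y - pder c finset.set0 x.
Proof.
move=> d0 pP top pos WW E; rewrite (diag_expansion c WW E).
rewrite [X in _ <= X - _](bigD1 finset.set0) //= pminor0 det1 mul1r addrAC subrr add0r.
rewrite mulr_sumr [X in _ <= X](bigID (fun K : {set 'I_n} => #|K| == d)) /=.
rewrite [X in _ <= X + _](_ : _ =
    \sum_(K : {set 'I_n} | #|K| == d) c d * \det (pminor K P)); last first.
  apply: eq_big => [K|K /andP[_ /eqP Kd]]; last by rewrite top // mulrC.
  by rewrite andb_idl // => /eqP Kd; rewrite -card_gt0 Kd.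
rewrite lerDl sumr_ge0 // => K /andP[K0 _].
by rewrite mulr_ge0 ?pos //; apply/psdmx_det_ge0/psdmx_pminor.
Qed.

(** Let E be the orthogonal projection on the eigenvectors of diag(x) + P indexed
by I.  Computed in the eigenbasis, the coefficient of X^|I| in the spectral
function of diag(x) + P + X E is the derivative in I at y.  Expanded around
diag(x), it is a combination of the derivatives at x with mixed discriminants of
P and E as coefficients; the derivative of order zero does not occur, since I
is nonempty. *)
Lemma spectral_mono n (c : nat -> C) (x y : 'rV[C]_n) (P W : 'M[C]_n) :
  psdmx P -> (forall K : {set 'I_n}, K != finset.set0 -> 0 <= pder c K x) ->
  W *m W ^t* = 1%:M -> W ^t* *m W = 1%:M ->
  diag_mx x + P = W ^t* *m diag_mx y *m W ->
  forall I : {set 'I_n}, I != finset.set0 -> 0 <= pder c I y.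
Proof.
move=> pP pos WW' WW E I I0.
pose F := W ^t* *m indic I *m W.
have pF : psdmx F by rewrite /F -{2}[W]adjK; apply/psdmx_conj/psdmx_indic.
pose pc : nat -> {poly C} := polyC \o c.
pose N := map_mx polyC (diag_mx x + P) + 'X *: map_mx polyC F.
have NE1 : N = diag_mx (map_mx polyC x)
    + (map_mx polyC P + 'X *: map_mx polyC F).
  by rewrite /N map_mxD map_diag_mx addrA.
have NE2 : N = map_mx polyC (W ^t*) *m (diag_mx (map_mx polyC y)
    + 'X *: map_mx polyC (indic I)) *m map_mx polyC W.
  rewrite mulmxDr mulmxDl -map_diag_mx -!map_mxM -E; congr (_ + _).
  by rewrite -scalemxAr -scalemxAl -!map_mxM.
have coefE : (specfun pc N)`_#|I| = pder c I y.
  rewrite NE2 specfun_conj; last by rewrite -map_mxM WW map_mx1.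
  rewrite specfun_expand coef_sum (bigD1 I) //= big1 ?addr0 => [|K KI].
    rewrite -rmorph_pder det_pminor_scale -map_pminor det_map_mx -mulrA.
    rewrite coefXnM ltnn subnn -rmorphM coefC eqxx /=.
    rewrite (_ : pminor I (indic I) = 1%:M) ?det1 ?mul1r //.
    apply/matrixP => i j; rewrite !mxE; case: ifP => // /andP[iI _].
    by rewrite iI.
  rewrite -rmorph_pder det_pminor_scale -map_pminor det_map_mx -mulrA.
  rewrite coefXnM; case: ltnP => // KI'; rewrite -rmorphM coefC.
  case: eqP => // /eqP; rewrite subn_eq0 => IK.
  have nsub : ~~ (K \subset I).
    by apply: contra KI => KsI; rewrite finset.eqEcard KsI IK.
  have [i iK iI] : exists2 i, i \in K & i \notin I by apply/fintype.subsetPn.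
  have : pminor K (indic I) = diag_mx (\row_i ((i \in K) ==> (i \in I))%:R).
    apply/matrixP => a b; rewrite !mxE.
    case: (eqVneq a b) => [<-|ab]; last by rewrite !mulr0n; case: ifP.
    by rewrite !mulr1n andbb; case: ifP.
  move=> ->; rewrite det_diag (bigD1 i) //= mxE iK (negPf iI) /= mul0r.
  by rewrite mul0r.
rewrite -coefE NE1 specfun_expand coef_sum sumr_ge0 // => K _.
rewrite -rmorph_pder coefMC.
have [->|K0] := eqVneq K finset.set0.
  by rewrite pminor0 det1 coef1 cards_eq0 (negPf I0) mul0r.
rewrite mulr_ge0 ?pos //.
have -> : pminor K (map_mx polyC P + 'X *: map_mx polyC F) =
    map_mx polyC (pminor K P) + 'X *: map_mx polyC (indic K *m F *m (indic K) ^t*).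
  apply/matrixP => i j.
  rewrite [RHS]mxE [X in _ = _ + X]mxE [X in _ = _ + _ * X]mxE compressE !mxE.
  case: ifP => _ //; rewrite polyC0 mulr0 addr0.
  by rewrite rmorph_nat.
by apply: psdmx_det_coef_ge0; [exact: psdmx_pminor|exact: psdmx_conj].
Qed.

End Semidefinite.

(** * Maclaurin inequality and trace bound *)

Lemma card_draws_notin n k (i : 'I_n) :
  #|[set J : {set 'I_n} | (i \notin J) && (#|J| == k)]%SET| = 'C(n.-1, k).
Proof.
have := cards_draws (~: [set i]%SET) k.
rewrite cardsC1 card_ord => <-; apply: eq_card => J.
by rewrite !inE finset.subsetC finset.sub1set inE.
Qed.

(** Apply the inequality of arithmetic and geometric means to the C(n, d) products
of d entries; each entry occurs in C(n - 1, d - 1) of them. *)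
Lemma maclaurin (R : realType) n d (x : 'rV[R]_n) : (0 < d <= n)%N ->
  (forall i, 0 <= x 0 i) ->
  (\prod_i x 0 i) `^ (d%:R / n%:R) <=
  (\sum_(K : {set 'I_n} | #|K| == d) \prod_(i in K) x 0 i) / 'C(n, d)%:R.
Proof.
move=> /andP[d0 dn] x0.
set s := \prod_i x 0 i; set e := \sum_(K | _) _.
have s0 : 0 <= s by apply: prodr_ge0.
have e0 : 0 <= e by apply: sumr_ge0 => K _; apply: prodr_ge0.
pose S := [set K : {set 'I_n} | #|K| == d]%SET.
have cS : #|S| = 'C(n, d) by rewrite card_draws card_ord.
have C0 : (0 < 'C(n, d))%N by rewrite bin_gt0.
have prodE : \prod_(K in S) \prod_(i in K) x 0 i = s ^+ 'C(n.-1, d.-1).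
  rewrite (exchange_big_dep predT) //= -prodrXl; apply: eq_bigr => i _.
  rewrite prodr_const; congr (_ ^+ _).
  have h := card_draws_notin d i.
  have : (#|[set K in S | i \in K]%SET| + 'C(n.-1, d) = 'C(n, d))%N.
    rewrite -h -cS -(cardsID [set K : {set 'I_n} | i \in K]%SET S); congr (_ + _)%N.
      by apply: eq_card => K; rewrite !inE.
    by apply: eq_card => K; rewrite !inE.
  have -> : ('C(n, d) = 'C(n.-1, d) + 'C(n.-1, d.-1))%N.
    by move: d0 dn; clear; case: n d => [|n] [|d] // _ _; rewrite binS.
  rewrite addnC => /addnI <-.
  by apply: eq_card => K; rewrite [LHS]unfold_in !inE.
have := @leif_AGM R _ (mem S) (fun K : {set 'I_n} => \prod_(i in K) x 0 i).
move=> /(_ (fun K _ => prodr_ge0 _ (fun i _ => x0 i))) [+ _].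
rewrite prodE cS (_ : \sum_(K in S) _ = e); last by apply: eq_bigl => K; rewrite inE.
set q := e / _; have q0 : 0 <= q by rewrite divr_ge0.
move=> h; have nz (m : nat) : (0 < m)%N -> m%:R != 0 :> R by rewrite pnatr_eq0 -lt0n.
have -> : d%:R / n%:R = 'C(n.-1, d.-1)%:R / 'C(n, d)%:R :> R.
  apply/eqP; rewrite eqr_div ?nz //; last lia.
  rewrite -!natrM eqr_nat; apply/eqP.
  by move: d0 dn; clear; case: n d => [|n] [|d] // _ _; rewrite /= -mul_bin_diag mulnC.
rewrite powRrM powR_mulrn // -[leRHS](powRr1 q0).
rewrite -[X in _ <= _ `^ X](mulfV (nz _ C0)) powRrM powR_mulrn //.
by apply: ge0_ler_powR; rewrite ?invr_ge0 ?ler0n ?nnegrE ?exprn_ge0.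
Qed.

Section TraceBound.
Context {R : realType} {n : nat} (c : nat -> R) (d : nat).
Hypotheses (d0 : (0 < d)%N) (dn : (d <= n)%N) (cd0 : 0 < c d).
Hypothesis cd : forall j, (d < j)%N -> c j = 0.

(** For J of size d - 1 the derivative is affine, with slope c_d in each of the
remaining variables.  Adding up over J gives a multiple of the sum of the x_i,
each variable being outside C(n - 1, d - 1) of the sets J. *)
Lemma trace_bound : exists2 b : R, 0 <= b & forall x : 'rV[R]_n,
  (forall J : {set 'I_n}, #|J| = d.-1 -> 0 <= pder c J x) ->
  - b <= \sum_i x 0 i.
Proof.
pose N := 'C(n.-1, d.-1); pose M := 'C(n, d.-1).
have N0 : (0 < N)%N by rewrite bin_gt0; lia.
have cN : 0 < c d * N%:R by rewrite mulr_gt0 ?ltr0n.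
exists (M%:R * `|c d.-1| / (c d * N%:R)) => [|x pos].
  by rewrite divr_ge0 ?mulr_ge0 // ltW.
have pE (J : {set 'I_n}) : #|J| = d.-1 ->
    pder c J x = c d.-1 + c d * \sum_(i in ~: J) x 0 i.
  move=> Jd; rewrite (@pder_polar _ _ _ _ _ (enum (~: J))) ?enum_uniq //; last first.
    by move=> i; rewrite mem_enum inE.
  rewrite polar_affine => [|j j1]; last by rewrite /shiftc cd //; nlia.
  rewrite /shiftc Jd addn0 addn1 prednK // big_map.
  by rewrite big_enum.
have : 0 <= \sum_(J : {set 'I_n} | #|J| == d.-1) pder c J x.
  by apply: sumr_ge0 => J /eqP; exact: pos.
rewrite (eq_bigr (fun J : {set 'I_n} => c d.-1 + c d * \sum_(i in ~: J) x 0 i));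
  last by move=> J /eqP; exact: pE.
rewrite big_split /= -mulr_sumr (exchange_big_dep predT) //=.
have -> : \sum_(J : {set 'I_n} | #|J| == d.-1) c d.-1 = M%:R * c d.-1.
  rewrite sumr_const mulr_natl; congr (_ *+ _).
  rewrite /M -[n in 'C(n, _)]card_ord -card_draws.
  by apply: eq_card => J; rewrite [LHS]unfold_in inE.
have -> : \sum_i \sum_(J : {set 'I_n} | (#|J| == d.-1) && (i \in ~: J)) x 0 i
    = N%:R * \sum_i x 0 i.
  rewrite mulr_sumr; apply: eq_bigr => i _.
  rewrite sumr_const mulr_natl; congr (_ *+ _).
  rewrite /N -(card_draws_notin d.-1 i); apply: eq_card => J.
  by rewrite [LHS]unfold_in !inE andbC.
move=> h; rewrite -(ler_pM2r cN) mulNr divfK ?gt_eqF //.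
have : - (M%:R * `|c d.-1|) <= - (M%:R * c d.-1).
  by rewrite lerN2 ler_wpM2l // ler_norm.
by lra.
Qed.

End TraceBound.

(** * Cones of spectra *)

Section HermitianPolarization.
Local Open Scope sesquilinear_scope.
Context {R : realType} {n : nat} (c : nat -> R) (d : nat).
Hypotheses (d0 : (0 < d)%N) (dn : (d <= n)%N) (cd : forall j, (d < j)%N -> c j = 0).
Hypotheses (cd0 : 0 < c d) (nest : forall y0, nested c n d y0).
Local Notation C := R[i].
Local Notation toC := (map_mx (real_complex R)).
Implicit Types (x y z : 'rV[R]_n) (N P V W : 'M[C]_n).

(** The set C_f^(1), by [garding_cone_poscone]. *)
Definition cone1 : set 'rV[R]_n := [set x | forall i, poscone c d [set i]%SET x].

(** The list x is not ordered: the definition of the eigenvalues of a form leaves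
the order open. *)
Definition spectrum N x : Prop := exists W : 'M[C]_n,
  [/\ W *m W ^t* = 1%:M, W ^t* *m W = 1%:M & N = W ^t* *m diag_mx (toC x) *m W].

Lemma cone1_ge0 x : cone1 x ->
  forall K : {set 'I_n}, K != finset.set0 -> 0 <= pder c K x.
Proof.
move=> Gx K /finset.set0Pn; case=> i iK; apply: (poscone_ge0 cd (Gx i)).
by rewrite finset.sub1set.
Qed.

(** Passing to a closed condition and back at the cost of a small shift is how
strict inequalities are recovered from weak ones. *)
Lemma cone1_shift x e : 0 < e ->
  (forall K : {set 'I_n}, K != finset.set0 -> 0 <= pder c K x) ->
  cone1 (x + const_mx e).
Proof.
move=> e0 pos i; apply: (pder_shift_gt0 dn cd cd0) => // I iI; apply: pos.
by apply/finset.set0Pn; exists i; rewrite -finset.sub1set.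
Qed.

Lemma continuous_diagonal x : continuous (fun u : R => x + const_mx u : 'rV[R]_n).
Proof.
have -> : (fun u : R => x + const_mx u : 'rV[R]_n) = (fun u => x + u *: const_mx 1).
  by apply: funext => u; congr (_ + _); apply/rowP => i; rewrite !mxE mulr1.
by move=> u; apply: cvgD; [exact: cvg_cst|apply: cvgZl; exact: cvg_id].
Qed.

Lemma diagonal0 x : x + const_mx 0 = x.
Proof. by apply/rowP => i; rewrite !mxE addr0. Qed.

Lemma cone1_limit x : (forall e, 0 < e -> cone1 (x + const_mx e)) ->
  forall K : {set 'I_n}, K != finset.set0 -> 0 <= pder c K x.
Proof.
move=> Gx K /finset.set0Pn; case=> i iK.
have : closure (poscone c d [set i]%SET) x.
  move=> B xB.
  have : \forall u \near (0 : R), B (x + const_mx u).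
    by apply: (@continuous_diagonal x 0 B); rewrite /= diagonal0.
  move=> /nbhs_ballP[e /= e0 He]; exists (x + const_mx (e / 2)).
  have e2 : 0 < e / 2 by rewrite divr_gt0.
  split; first exact: (Gx _ e2 i).
  by apply: He; rewrite /ball /= sub0r normrN gtr0_norm //; lra.
move/(closure_poscone cd); apply.
by rewrite finset.sub1set.
Qed.

Lemma open_cone1 : open cone1.
Proof.
rewrite openE => x Gx; rewrite /interior.
apply: (@filter_forall _ 'I_n (fun i y => poscone c d [set i]%SET y) (nbhs x) _) => i.
by apply: open_nbhs_nbhs; split; [exact: (open_poscone (n := n))|exact: Gx].
Qed.

Lemma open_lower (U : set 'rV[R]_n) x : open U -> U x ->
  exists2 e, 0 < e & U (x - const_mx e).
Proof.
move=> oU Ux; have : \forall u \near (0 : R), U (x + const_mx u).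
  apply: (@continuous_diagonal x 0 U); rewrite /= diagonal0.
  exact: open_nbhs_nbhs.
move=> /nbhs_ballP[e /= e0 He]; exists (e / 2); first by rewrite divr_gt0.
rewrite (_ : x - _ = x + const_mx (- (e / 2))); last first.
  by apply/rowP => i; rewrite !mxE.
by apply: He; rewrite /ball /= sub0r opprK gtr0_norm ?divr_gt0 //; lra.
Qed.

Lemma pder0_C x (I : {set 'I_n}) :
  pder (real_complex R \o c) I (toC x) = (pder c I x)%:C%C.
Proof. by rewrite -rmorph_pder. Qed.

Lemma spectrum_shift N x e : spectrum N x ->
  spectrum (N + (e%:C%C)%:M) (x + const_mx e).
Proof.
move=> [W [WW WW' ->]]; exists W; split=> //.
have -> : diag_mx (toC (x + const_mx e)) = diag_mx (toC x) + (e%:C%C)%:M.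
  apply/matrixP => i j; rewrite !mxE raddfD /= mulrnDl.
  by [].
by rewrite mulmxDr mulmxDl mul_mx_scalar -scalemxAl WW' scalemx1.
Qed.

Lemma spectrum_frame N P x y : spectrum N x -> spectrum (N + P) y -> psdmx P ->
  exists P', exists U : 'M[C]_n, exists V : 'M[C]_n,
  [/\ psdmx P', U *m U ^t* = 1%:M, U ^t* *m U = 1%:M,
    diag_mx (toC x) + P' = U ^t* *m diag_mx (toC y) *m U &
    [/\ P' = V *m P *m V ^t*, V *m V ^t* = 1%:M & V ^t* *m V = 1%:M]].
Proof.
move=> [V [VV VV' ->]] [W [WW WW' E]] pP.
exists (V *m P *m V ^t*), (W *m V ^t*), V; split=> //.
- exact: psdmx_conj.
- by rewrite adjM adjK -mulmxA [V ^t* *m _]mulmxA VV' mul1mx.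
- by rewrite adjM adjK -mulmxA [W ^t* *m _]mulmxA WW' mul1mx.
- rewrite adjM adjK.
  have -> : V *m W ^t* *m diag_mx (toC y) *m (W *m V ^t*) =
      V *m (W ^t* *m diag_mx (toC y) *m W) *m V ^t* by rewrite !mulmxA.
  rewrite -E mulmxDr mulmxDl; congr (_ + _).
  by rewrite !mulmxA VV mul1mx -mulmxA VV mulmx1.
Qed.

(** Shift x down by a small e, inside the cone; the weak inequalities that
[spectral_mono] gives for y - e become strict at y. *)
Lemma cone1_mono N P x y : spectrum N x -> spectrum (N + P) y -> psdmx P ->
  cone1 x -> cone1 y.
Proof.
move=> sx sy pP Gx; have [e e0 Ge] := open_lower open_cone1 Gx.
rewrite -[y](subrK (const_mx e)); apply: cone1_shift => // I I0.
have sx' := spectrum_shift (- e) sx; have sy' := spectrum_shift (- e) sy.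
rewrite addrAC in sy'.
have [P' [U [_ [pP' UU UU' E _]]]] := spectrum_frame sx' sy' pP.
have cN : const_mx (- e) = - const_mx e :> 'rV[R]_n.
  by apply/rowP => i; rewrite !mxE.
rewrite cN in E.
rewrite -lecR -pder0_C.
apply: (spectral_mono pP' _ UU UU' E I0) => K K0.
by rewrite pder0_C lecR; apply: cone1_ge0 Ge _ K0.
Qed.

Lemma spectrum_gain N P x y z : spectrum N x -> spectrum (N + P) y -> psdmx P ->
  spectrum P z ->
  (forall K : {set 'I_n}, K != finset.set0 -> 0 <= pder c K x) ->
  c d * (\sum_(K : {set 'I_n} | #|K| == d) \prod_(i in K) z 0 i)
  <= pder c finset.set0 y - pder c finset.set0 x.
Proof.
move=> sx sy pP [W [_ WW PE]] pos.
have [P' [U [V [pP' UU UU' E [P'E VV VV']]]]] := spectrum_frame sx sy pP.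
have P'E' : P' = (W *m V ^t*) ^t* *m diag_mx (toC z) *m (W *m V ^t*).
  by rewrite P'E PE adjM adjK !mulmxA.
have UU2 : (W *m V ^t*) ^t* *m (W *m V ^t*) = 1%:M.
  by rewrite adjM adjK -mulmxA [W ^t* *m _]mulmxA WW mul1mx.
rewrite -lecR rmorphM rmorphB /= -!pder0_C rmorph_sum /=.
have -> : \sum_(K : {set 'I_n} | #|K| == d) real_complex R (\prod_(i in K) z 0 i)
    = \sum_(K : {set 'I_n} | #|K| == d) \prod_(i in K) (toC z) 0 i.
  apply: eq_bigr => K _; rewrite rmorph_prod; apply: eq_bigr => i _.
  by rewrite mxE.
rewrite (esym_pminor d UU2 P'E').
apply: (@spectral_gain _ _ (real_complex R \o c) _ _ _ _ U) => //.
- by move=> K Kd; rewrite pder0_C (pder_top cd).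
- by move=> K K0; rewrite pder0_C lecR; exact: pos.
Qed.

End HermitianPolarization.

(** * Spectra and matrix norms *)

Section Spectrum.
Local Open Scope sesquilinear_scope.
Context {R : realType}.
Local Notation C := R[i].

Lemma char_poly_conj (F : comNzRingType) n (Q' Q N : 'M[F]_n) : Q' *m Q = 1%:M ->
  char_poly (Q' *m N *m Q) = char_poly N.
Proof.
move=> QQ; have QQp : map_mx polyC Q' *m map_mx polyC Q = 1%:M.
  by rewrite -map_mxM QQ map_mx1.
rewrite /char_poly (_ : char_poly_mx _ =
    map_mx polyC Q' *m char_poly_mx N *m map_mx polyC Q).
  by rewrite !det_mulmx mulrAC -det_mulmx QQp det1 mul1r.
rewrite /char_poly_mx mulmxBr mulmxBl !map_mxM; congr (_ - _).
by rewrite mul_mx_scalar -scalemxAl QQp scalemx1.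
Qed.

(** The spectral theorem yields the eigenvalues in some order; permuting the rows
of the unitary matrix puts them in the order of x. *)
Lemma spectrum_char_poly n (N : 'M[C]_n) (x : 'rV[R]_n) : N ^t* = N ->
  char_poly N = \prod_(i < n) ('X - ((x 0 i)%:C%C)%:P) -> spectrum N x.
Proof.
move=> hN; have [Q [y [QQ QQ' NE]]] := hermitian_spectral hN.
rewrite NE char_poly_conj // char_poly_trig ?diag_mx_is_trig // => E.
pose tx := [tuple (x 0 i)%:C%C | i < n]; pose ty := [tuple y 0 i | i < n].
have /tuple_permP[s ysE] : perm_eq ty tx.
  apply: prod_XsubC_eq; rewrite !big_map -!enumT !big_enum /= -E.
  by apply: eq_bigr => i _; rewrite mxE eqxx mulr1n.
have ysi i : y 0 i = (x 0 (s i))%:C%C.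
  have := congr1 (fun t => tnth t i) (val_inj ysE).
  by rewrite !tnth_mktuple.
exists (row_perm s^-1 Q); split.
- apply/matrixP => i j; have /matrixP/(_ (s^-1 i)%g (s^-1 j)%g) := QQ.
  rewrite !mxE (inj_eq perm_inj) => <-; apply: eq_bigr => k _.
  by rewrite !mxE.
- apply/matrixP => i j; have /matrixP/(_ i j) := QQ'.
  rewrite !mxE => <-; rewrite (reindex_inj (@perm_inj _ s)) /=.
  by apply: eq_bigr => k _; rewrite !mxE permK.
- apply/matrixP => i j; rewrite !mul_mx_diag !mxE [RHS](reindex_inj (@perm_inj _ s)) /=.
  by apply: eq_bigr => k _; rewrite !mxE permK ysi.
Qed.

(** Crude estimate of the form of T E T^* by the largest entry of E; any bound
linear in that entry would do. *)
Lemma qform_bound n (T E : 'M[C]_n) (e : C) (v : 'rV[C]_n) : 0 <= e ->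
  (forall i j, `|E i j| <= e) ->
  `|qform (T *m E *m T ^t*) v| <=
  e * ((\sum_i \sum_j `|T i j|) * n%:R) ^+ 2 * \sum_i `|v 0 i| ^+ 2.
Proof.
move=> e0 Ee; rewrite qform_conj; set u := v *m T.
set tau := \sum_i \sum_j _; set S := \sum_i `|v 0 i| ^+ 2.
have tau0 : 0 <= tau by rewrite !sumr_ge0 // => i _; rewrite sumr_ge0.
pose s := \sum_i `|v 0 i|; have s0 : 0 <= s by rewrite sumr_ge0.
have S0 i : `|v 0 i| ^+ 2 <= S.
  by rewrite /S (bigD1 i) //= lerDl sumr_ge0 // => j _; rewrite exprn_ge0.
have sS : s ^+ 2 <= n%:R ^+ 2 * S.
  rewrite expr2 /s mulr_suml (@le_trans _ _ (\sum_(i < n) n%:R * S)) //; last first.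
    by rewrite sumr_const card_ord -[(_ * _) *+ n]mulr_natl mulrA expr2.
  apply: ler_sum => i _; rewrite mulr_sumr.
  rewrite (@le_trans _ _ (\sum_(j < n) S)) //; last first.
    by rewrite sumr_const card_ord mulr_natl.
  apply: ler_sum => j _.
  have h : (`|v 0 i| - `|v 0 j|) ^+ 2 >= 0.
    by apply: real_exprn_even_ge0 => //; rewrite realB ?normr_real.
  rewrite -(ler_pM2l (ltr0Sn _ 1)).
  apply: (@le_trans _ _ (`|v 0 i| ^+ 2 + `|v 0 j| ^+ 2)).
    rewrite -subr_ge0; apply: le_trans h _; rewrite le_eqVlt; apply/orP; left.
    by apply/eqP; ring.
  by rewrite mulrDl !mul1r lerD.
have uj j : `|u 0 j| <= \sum_i `|v 0 i| * `|T i j|.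
  rewrite mxE; apply: le_trans (ler_norm_sum _ _ _) _.
  by apply: ler_sum => i _; rewrite normrM.
have su : \sum_j `|u 0 j| <= s * tau.
  apply: (@le_trans _ _ (\sum_j \sum_i `|v 0 i| * `|T i j|)).
    by apply: ler_sum => j _; exact: uj.
  rewrite exchange_big /= /s mulr_suml; apply: ler_sum => i _.
  rewrite -mulr_sumr ler_wpM2l // /tau [leRHS](bigD1 i) //= lerDl sumr_ge0 // => k _.
  by rewrite sumr_ge0.
apply: (@le_trans _ _ (e * (\sum_j `|u 0 j|) ^+ 2)).
  rewrite /qform mxE; apply: le_trans (ler_norm_sum _ _ _) _.
  rewrite expr2 mulrCA [leRHS]mulr_suml; apply: ler_sum => j _.
  rewrite normrM !mxE norm_conjC mulrC ler_wpM2l // mulr_sumr.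
  apply: le_trans (ler_norm_sum _ _ _) _; apply: ler_sum => i _.
  by rewrite normrM mulrC ler_wpM2r.
rewrite -mulrA ler_wpM2l //.
apply: (@le_trans _ _ ((s * tau) ^+ 2)).
  by rewrite ler_pXn2r ?nnegrE ?sumr_ge0 // mulr_ge0.
by rewrite !exprMn [leLHS]mulrC -[leRHS]mulrA ler_wpM2l ?exprn_ge0.
Qed.

End Spectrum.

(** * Hermitian forms in an orthonormal frame *)

Lemma near_preimage (T U : topologicalType) (f : T -> U) x (B : set U) :
  continuous f -> nbhs (f x) B -> nbhs x (f @^-1` B).
Proof. by move=> cf; exact: cf. Qed.

Section HermitianForms.
Local Open Scope sesquilinear_scope.
Context {R : realType} {V : vectType R[i]}.
Local Notation C := R[i].
Local Notation n := (\dim {:V}).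
Implicit Types (A P : hermform V) (v w : 'rV[C]_n).

Definition lincomb v : V := \sum_i v 0 i *: (vbasis {:V})`_i.

Lemma lincomb_eq0 v : lincomb v = 0 -> v = 0.
Proof.
move=> v0; apply/rowP => i; rewrite mxE.
by have /freeP := basis_free (vbasisP {:V}); apply.
Qed.

Lemma form_gram (B : V -> V -> C) v w : B \in is_hermform ->
  B (lincomb v) (lincomb w) = (v *m gram B *m w ^t*) 0 0.
Proof.
move=> /is_hermformP[lin herm].
have suml (u : 'rV[C]_n) z : B (lincomb u) z = \sum_i u 0 i * B (vbasis {:V})`_i z.
  have B0 : B 0 z = 0 by have := lin z (-1) 0 0; rewrite scaler0 addr0 mulN1r addNr.
  rewrite /lincomb; elim/big_rec2: _ => [//|i a b _ <-].
  exact: lin.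
rewrite suml mxE [RHS](eq_bigr (fun j : 'I_n => \sum_i
    v 0 i * (B (vbasis {:V})`_i (vbasis {:V})`_j * (w 0 j)^*))); last first.
  by move=> j _; rewrite !mxE mulr_suml; apply: eq_bigr => i _; rewrite !mxE mulrA.
rewrite exchange_big; apply: eq_bigr => i _ /=; rewrite -mulr_sumr; congr (_ * _).
rewrite herm suml rmorph_sum; apply: eq_bigr => j _.
by rewrite rmorphM /= -herm mulrC.
Qed.

Lemma hermformP A : hform A \in is_hermform.
Proof. by case: A. Qed.

Lemma gram_adj (B : V -> V -> C) : B \in is_hermform -> (gram B) ^t* = gram B.
Proof.
move=> /is_hermformP[_ herm]; apply/matrixP => i j.
by rewrite !mxE /= -herm.
Qed.

Lemma gramD A P : gram (A + P) = gram A + gram P.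
Proof. by apply/matrixP => i j; rewrite !mxE. Qed.

Lemma qform_gram (B : V -> V -> C) v : B \in is_hermform ->
  qform (gram B) v = B (lincomb v) (lincomb v).
Proof. by move=> hB; rewrite /qform form_gram. Qed.

Section Frame.
Variable (rho : {dot V for Num.conj}).

Lemma dot_hermform : (rho : V -> V -> C) \in is_hermform.
Proof. by rewrite unfold_in; apply/asboolP; exists rho. Qed.

(** Diagonalize the Gram matrix of rho and rescale by the square roots of its
eigenvalues. *)
Lemma orthonormal_frame : exists T : 'M[C]_n, T *m gram rho *m T ^t* = 1%:M.
Proof.
have [Q [x [QQ QQ' GE]]] := hermitian_spectral (gram_adj dot_hermform).
have x0 i : 0 < x 0 i.
  rewrite (spectral_entry i QQ GE) qform_gram ?dot_hermform // dnorm_gt0.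
  apply/eqP => /lincomb_eq0 Qi0.
  have /matrixP/(_ i i) := QQ; rewrite !mxE eqxx big1 => [/eqP|j _].
    by rewrite eq_sym oner_eq0.
  by have /rowP/(_ j) := Qi0; rewrite !mxE => ->; rewrite mul0r.
pose h : 'rV[C]_n := \row_i (sqrtC (x 0 i))^-1.
exists (diag_mx h *m Q); rewrite GE adjM !mulmxA -[diag_mx h *m Q *m Q ^t*]mulmxA QQ mulmx1.
rewrite -!mulmxA [Q *m _]mulmxA QQ mul1mx tr_diag_mx map_diag_mx.
apply/matrixP => i j; rewrite !mul_diag_mx !mxE.
case: (eqVneq i j) => [_|ij]; last by rewrite mulr0n !mulr0.
rewrite !mulr1n /= geC0_conj ?invr_ge0 ?sqrtC_ge0 ?ltW //.
rewrite mulrC -mulrA -invfM -expr2 sqrtCK mulfV //.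
by rewrite gt_eqF.
Qed.

Variable (T : 'M[C]_n).
Hypothesis TG : T *m gram rho *m T ^t* = 1%:M.

(** The Hermitian matrix of A in a rho-orthonormal frame; its eigenvalues are the
ones of A relative to rho. *)
Definition nform A : 'M[C]_n := T *m gram A *m T ^t*.

Lemma frame_unit : T \in unitmx.
Proof. by have [] := mulmx1_unit (etrans (mulmxA _ _ _) TG). Qed.

Lemma nformD A P : nform (A + P) = nform A + nform P.
Proof. by rewrite /nform gramD mulmxDr mulmxDl. Qed.

Lemma nform_adj A : (nform A) ^t* = nform A.
Proof. by rewrite /nform !adjM adjK gram_adj ?hermformP // mulmxA. Qed.

Lemma qform_nform A v : qform (nform A) v = A (lincomb (v *m T)) (lincomb (v *m T)).
Proof. by rewrite qform_conj qform_gram ?hermformP. Qed.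

Lemma nform_psd P : semipositive P -> psdmx (nform P).
Proof. by move=> pP; split=> [|v]; [exact: nform_adj|rewrite qform_nform]. Qed.

(** The matrix that defines the eigenvalues relative to rho is conjugate to the
normal form, since the inverse of the Gram matrix of rho is T^* T. *)
Lemma eigvals_spectrum A : spectrum (nform A) (eigvals rho A).
Proof.
apply: spectrum_char_poly; first exact: nform_adj.
have E : is_eigvals rho A (eigvals rho A).
  exact: (xgetPex 0 (exists_eigvals rho A)).
rewrite /is_eigvals in E; rewrite -E.
have Tu := frame_unit.
have GE : invmx (gram rho) = T ^t* *m T.
  have GTT : gram rho *m (T ^t* *m T) = 1%:M.
    by apply: (can_inj (mulKmx Tu)); rewrite mulmx1 !mulmxA TG mul1mx.
  have [Gu _] := mulmx1_unit GTT.
  by rewrite -[LHS]mulmx1 -GTT mulKmx.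
have conjE : gram A *m invmx (gram rho) = invmx T *m nform A *m T.
  have NE : invmx T *m nform A = gram A *m T ^t*.
    by rewrite /nform -[_ *m _ *m T ^t*]mulmxA (mulKmx Tu).
  by rewrite NE GE mulmxA.
by rewrite conjE; apply/esym/char_poly_conj/mulVmx.
Qed.

Lemma eigvals_pos P i : positive_definite P -> 0 < eigvals rho P 0 i.
Proof.
move=> pP; have [W [WW _ PE]] := eigvals_spectrum P.
have : 0 < (map_mx (real_complex R) (eigvals rho P)) 0 i.
  rewrite (spectral_entry i WW PE) qform_nform; apply: pP.
  apply/eqP => /lincomb_eq0 /(congr1 (mulmx^~ (invmx T))).
  rewrite mulmxK ?frame_unit // mul0mx => Wi0.
  have /matrixP/(_ i i) := WW; rewrite !mxE eqxx big1 => [/eqP|j _].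
    by rewrite eq_sym oner_eq0.
  by have /rowP/(_ j) := Wi0; rewrite !mxE => ->; rewrite mul0r.
by rewrite mxE ltcR.
Qed.

Lemma eigvals_ge0 P i : semipositive P -> 0 <= eigvals rho P 0 i.
Proof.
move=> pP; have [W [WW _ PE]] := eigvals_spectrum P.
have : 0 <= (map_mx (real_complex R) (eigvals rho P)) 0 i.
  by rewrite (spectral_entry i WW PE) qform_nform; apply: pP.
by rewrite mxE lecR.
Qed.

(** The order interval between A0 - e rho and A0 + e rho is a neighbourhood of A0:
a small change of the Gram matrix changes the normal form by little in norm. *)
Lemma near_nform A0 (e : R) : 0 < e -> \forall A \near A0,
  psdmx ((e%:C%C)%:M + (nform A - nform A0)) /\
  psdmx ((e%:C%C)%:M - (nform A - nform A0)).
Proof.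
move=> e0; pose tau : C := \sum_i \sum_j `|T i j|.
have tau0 : 0 <= tau by rewrite !sumr_ge0 // => i _; rewrite sumr_ge0.
(* The norm of T E T^* is at most kappa times the largest entry of E; the
summand 1 makes kappa positive. *)
pose kappa := (tau * n%:R) ^+ 2 + 1.
have k0 : 0 < kappa by rewrite ltr_wpDl ?exprn_ge0 ?mulr_ge0.
have eC : 0 < e%:C%C by rewrite ltcR.
pose de := e%:C%C / kappa; have de0 : 0 < de by rewrite divr_gt0.
have cont : continuous (fun A : hermform V => gram A : 'M[C^o]_n).
  exact: initial_continuous.
have nb : nbhs (gram A0 : 'M[C^o]_n) (ball (gram A0 : 'M[C^o]_n) de).
  exact: nbhsx_ballx.
have near1 := near_preimage cont nb.
apply: filterS near1 => A [_ HA].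
set E := gram A - gram A0.
have EE : nform A - nform A0 = T *m E *m T ^t*.
  by rewrite /nform /E mulmxBr mulmxBl.
have E_le i j : `|E i j| <= de.
  have := HA i j; rewrite /ball /= => h.
  by move: h; rewrite !mxE distrC => /ltW.
have bound v : `|qform (nform A - nform A0) v| <= e%:C%C * \sum_i `|v 0 i| ^+ 2.
  rewrite EE; apply: le_trans (qform_bound _ _ (ltW de0) E_le) _.
  apply: ler_wpM2r; first by rewrite sumr_ge0 // => i _; rewrite exprn_ge0.
  rewrite /de mulrAC ler_pdivrMr // ler_wpM2l ?(ltW eC) //.
  by rewrite /kappa lerDl ler01.
have hE : (nform A - nform A0) ^t* = nform A - nform A0.
  by rewrite linearB /= map_mxB !nform_adj.
have he : ((e%:C%C)%:M : 'M[C]_n) ^t* = (e%:C%C)%:M.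
  by rewrite tr_scalar_mx map_scalar_mx /= geC0_conj // ltW.
have qe v : qform ((e%:C%C)%:M) v = e%:C%C * \sum_i `|v 0 i| ^+ 2.
  rewrite -diag_const_mx qform_diag mulr_sumr; apply: eq_bigr => i _.
  by rewrite mxE.
have real v : qform (nform A - nform A0) v \is Num.real.
  apply/CrealP; set N := nform A - nform A0 in hE *.
  have : (v *m N *m v ^t*) ^t* = v *m N *m v ^t* by rewrite !adjM adjK hE mulmxA.
  by move=> /matrixP/(_ 0 0); rewrite [LHS]mxE [X in Num.conj X = _]mxE.
have qN v : qform (- (nform A - nform A0)) v = - qform (nform A - nform A0) v.
  by rewrite /qform mulmxN mulNmx mxE.
split; split.
- by rewrite linearD /= map_mxD he hE.
- move=> v; rewrite qformD qe -[X in _ + X]opprK subr_ge0.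
  by apply: le_trans (bound v); rewrite -normrN real_ler_norm // rpredN.
- by rewrite linearB /= map_mxB he hE.
- move=> v; rewrite qformD qe qN subr_ge0.
  by apply: le_trans (bound v); rewrite real_ler_norm.
Qed.

End Frame.
End HermitianForms.

(** * The set of admissible eigenvalues *)

Section GammaSet.
Local Open Scope sesquilinear_scope.
Context {R : realType} {n : nat} (c : nat -> R) (d : nat).
Hypotheses (d0 : (0 < d)%N) (dn : (d <= n)%N) (cd : forall j, (d < j)%N -> c j = 0).
Hypotheses (cd0 : 0 < c d) (nest : forall y0, nested c n d y0).
Local Notation C := R[i].
Implicit Types (x y z : 'rV[R]_n) (N P W : 'M[C]_n).

(** The set written Gamma_f, with the Garding components in explicit form. *)
Definition gamma_set : set 'rV[R]_n :=
  if (2 <= d)%N then cone1 c d else poscone c d finset.set0.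

Lemma gamma_cone1 : gamma_set `<=` cone1 c d.
Proof.
rewrite /gamma_set; case: ifP => _ x Ux i; first exact: Ux.
by apply: posconeS Ux; exact: finset.sub0set.
Qed.

(** The cases d >= 2 and d = 1 only differ in the condition that f be positive,
which is inherited by points where f is larger. *)
Lemma gamma_up x y : gamma_set x -> cone1 c d y ->
  pder c finset.set0 x <= pder c finset.set0 y -> gamma_set y.
Proof.
rewrite /gamma_set; case: ifP => // _ Ux Gy xy I _ Id.
have [->|/finset.set0Pn] := eqVneq I finset.set0.
  by apply: lt_le_trans xy; apply: Ux; rewrite ?cards0.
by case=> i iI; apply: (Gy i) => //; rewrite finset.sub1set.
Qed.

Lemma gamma_open : open gamma_set.
Proof. by rewrite /gamma_set; case: ifP => _; [exact: open_cone1|exact: open_poscone]. Qed.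

(** If f were positive at such a point, [poscone_boundary] would place the point
in the component of f, which is contained in the domain. *)
Lemma gamma_boundary x :
  (forall K : {set 'I_n}, K != finset.set0 -> 0 <= pder c K x) ->
  ~ gamma_set x -> pder c finset.set0 x <= 0.
Proof.
move=> pos nD; rewrite leNgt; apply/negP => f0; apply: nD.
have U0 : poscone c d finset.set0 x.
  apply: (poscone_boundary dn cd cd0 nest) => // I _.
  by have [->|/pos//] := eqVneq I finset.set0; exact: ltW.
rewrite /gamma_set; case: ifP => // _ i.
by apply: posconeS U0; exact: finset.sub0set.
Qed.

Lemma gamma_const : exists t, gamma_set (const_mx t).
Proof.
have [t Ut] := poscone_neq0 dn cd cd0.
exists t; rewrite /gamma_set; case: ifP => // _ i.
by apply: posconeS Ut; exact: finset.sub0set.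
Qed.

Lemma gamma_ge0 x (J : {set 'I_n}) : gamma_set x -> #|J| = d.-1 -> 0 <= pder c J x.
Proof.
move=> Dx Jd; have [J0|/(cone1_ge0 cd (gamma_cone1 Dx))//] :=
  eqVneq J finset.set0.
have d1 : d = 1%N by rewrite J0 cards0 in Jd; lia.
move: Dx; rewrite /gamma_set d1 /= => Ux; rewrite J0.
by apply/ltW/Ux; rewrite ?cards0.
Qed.

Lemma psd_spectrum P : psdmx P -> exists2 z, spectrum P z & forall i, 0 <= z 0 i.
Proof.
move=> /psdmx_spectral[W [x [WW WW' PE x0]]].
have xE i : (complex.Re (x 0 i))%:C%C = x 0 i by apply: RRe_real; exact: ger0_real.
exists (\row_i complex.Re (x 0 i)); last by move=> i; rewrite mxE -lecR xE.
have zx : map_mx (real_complex R) (\row_i complex.Re (x 0 i)) = x.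
  by apply/rowP => i; rewrite !mxE xE.
by exists W; split; rewrite ?zx.
Qed.

(** Both the domain and f increase with the matrix. *)
Lemma gamma_mono N P x y : spectrum N x -> spectrum (N + P) y -> psdmx P ->
  gamma_set x -> gamma_set y /\ pder c finset.set0 x <= pder c finset.set0 y.
Proof.
move=> sx sy pP Dx; have [z sz z0] := psd_spectrum pP.
have G := gamma_cone1 Dx.
have fxy : pder c finset.set0 x <= pder c finset.set0 y.
  rewrite -subr_ge0.
  apply: le_trans (spectrum_gain d0 cd sx sy pP sz (cone1_ge0 cd G)).
  by rewrite mulr_ge0 ?(ltW cd0) // sumr_ge0 // => K _; rewrite prodr_ge0.
split=> //; apply: gamma_up Dx _ fxy.
exact: (cone1_mono dn cd cd0 sx sy pP G).
Qed.

Lemma spectrum_scalar (t : R) : spectrum ((t%:C%C)%:M : 'M[C]_n) (const_mx t).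
Proof.
exists 1%:M; rewrite trmx1 map_mx1; split; rewrite ?mulmx1 ?mul1mx //.
by apply/matrixP => i j; rewrite !mxE.
Qed.

End GammaSet.

(** * Admissibility *)

Section Admissible.
Local Open Scope sesquilinear_scope.
Context {R : realType} {V : vectType R[i]} (rho : {dot V for Num.conj}).
Local Notation C := R[i].
Local Notation n := (\dim {:V}).
Variables (c : nat -> R) (d : nat).
Hypotheses (d0 : (0 < d)%N) (dn : (d <= n)%N) (cd : forall j, (d < j)%N -> c j = 0).
Hypotheses (cd0 : 0 < c d) (nest : forall y0, nested c n d y0).
Variable (T : 'M[C]_n).
Hypothesis TG : T *m gram rho *m T ^t* = 1%:M.
Implicit Types (A P : hermform V).

Let G A : R := pder c finset.set0 (eigvals rho A).
Let Ap : set (hermform V) := [set A | gamma_set c d (eigvals rho A)].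

Lemma scaled_hermform (t : R) :
  (fun u v => t%:C%C * rho u v : C) \in @is_hermform R V.
Proof.
have /is_hermformP[lin herm] := dot_hermform rho.
apply/is_hermformP; split=> [v a x y|u v].
  by rewrite lin mulrDr mulrCA.
by rewrite rmorphM /= -herm; congr (_ * _); rewrite -[LHS]conjc_real.
Qed.

Lemma eigvals_mono A P : semipositive P -> Ap A -> Ap (A + P) /\ G A <= G (A + P).
Proof.
move=> pP; have sAP := eigvals_spectrum TG (A + P); rewrite nformD in sAP.
exact: (gamma_mono d0 dn cd cd0 (eigvals_spectrum TG A) sAP (nform_psd T pP)).
Qed.

Lemma eigvals_gain A P : cone1 c d (eigvals rho A) -> semipositive P ->
  c d * sigma rho d P <= G (A + P) - G A.
Proof.
move=> GA pP; have sAP := eigvals_spectrum TG (A + P); rewrite nformD in sAP.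
rewrite /sigma mpeval_mesym.
exact: (spectrum_gain d0 cd (eigvals_spectrum TG A) sAP (nform_psd T pP)
  (eigvals_spectrum TG P) (cone1_ge0 cd GA)).
Qed.

(** Large multiples of rho belong to the domain. *)
Lemma forms_nonempty : Ap !=set0.
Proof.
have [t Dt] := gamma_const dn cd cd0.
exists (HermForm (scaled_hermform t)).
set A := HermForm _.
have nA : nform T A = (t%:C%C)%:M.
  rewrite /nform (_ : gram A = t%:C%C *: gram rho); last first.
    by apply/matrixP => i j; rewrite !mxE.
  by rewrite -scalemxAr -scalemxAl TG scalemx1.
have sA := eigvals_spectrum TG A; rewrite nA -[X in spectrum X _]addr0 in sA.
have p0 : psdmx (0 : 'M[C]_n).
  split; first by rewrite trmx0 map_mx0.
  by move=> v; rewrite /qform mulmx0 mul0mx mxE.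
by have [] := gamma_mono d0 dn cd cd0 (spectrum_scalar t) sA p0 Dt.
Qed.

(** A point of the domain stays in it when lowered by a small multiple of rho, and
all forms near A lie above A - e rho. *)
Lemma forms_open : open Ap.
Proof.
rewrite openE => A DA; rewrite /interior.
have [e e0 De] := open_lower (@gamma_open _ _ c d) DA.
have nb := near_nform T A e0.
change (nbhs A Ap).
move: nb; apply: filterS => B [pB _].
have cN : const_mx (- e) = - const_mx e :> 'rV[R]_n by apply/rowP => i; rewrite !mxE.
have sA := spectrum_shift (- e) (eigvals_spectrum TG A); rewrite cN in sA.
have sB := eigvals_spectrum TG B.
have nB : nform T B = nform T A + ((- e)%:C%C)%:M
    + ((e%:C%C)%:M + (nform T B - nform T A)).
  rewrite rmorphN /= raddfN /= addrA subrK addrC subrK.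
  by [].
rewrite nB in sB.
by have [] := gamma_mono d0 dn cd cd0 sA sB pB De.
Qed.

(** A form of the domain lies below A0 + e rho when it is close to A0, and the
eigenvalues of A0 + e rho are those of A0 raised by e. *)
Lemma forms_near_below A0 B (e : R) : Ap B ->
  psdmx ((e%:C%C)%:M - (nform T B - nform T A0)) ->
  gamma_set c d (eigvals rho A0 + const_mx e) /\
  G B <= pder c finset.set0 (eigvals rho A0 + const_mx e).
Proof.
move=> DB pB; have sA := spectrum_shift e (eigvals_spectrum TG A0).
have sB := eigvals_spectrum TG B.
have nA : nform T A0 + (e%:C%C)%:M = nform T B
    + ((e%:C%C)%:M - (nform T B - nform T A0)).
  by rewrite opprB addrCA [_ + (_ - _)]addrC subrK addrC.
rewrite nA in sA.
exact: (gamma_mono d0 dn cd cd0 sB sA pB DB).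
Qed.

(** Near A0 the values of G are at most f(l + e), where l lists the eigenvalues of
A0.  As e decreases to 0 this tends to f(l), which is nonpositive at a boundary
point. *)
Lemma forms_limsup A0 : (closure Ap `\` interior Ap) A0 ->
  (limf_esup (EFin \o G) (within Ap (nbhs A0)) <= 0)%E.
Proof.
have /interior_id -> := forms_open.
move=> [clA nA].
set x := eigvals rho A0.
have Dx e : 0 < e -> gamma_set c d (x + const_mx e).
  move=> e0; have [B [DB [_ pB]]] := clA _ (near_nform T A0 e0).
  by have [] := forms_near_below DB pB.
have pos := cone1_limit cd (fun e e0 => gamma_cone1 (Dx e e0)).
have f0 : pder c finset.set0 x <= 0 by exact: (gamma_boundary dn cd cd0 nest pos nA).
apply/lee_addgt0Pr => r r0; rewrite add0e.
have : \forall u \near (0 : R), pder c finset.set0 (x + const_mx u) < r.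
  have fx : pder c finset.set0 x < r by apply: le_lt_trans r0.
  apply: (@continuous_diagonal _ _ x 0 (fun y => pder c finset.set0 y < r)).
  rewrite /= diagonal0.
  exact: (@continuous_pder _ _ c finset.set0 x _ (lt_nbhsl fx)).
move=> /nbhs_ballP[e /= e0 He].
have e2 : 0 < e / 2 by rewrite divr_gt0.
have fe : pder c finset.set0 (x + const_mx (e / 2)) < r.
  by apply: He; rewrite /ball /= sub0r normrN gtr0_norm //; lra.
rewrite /limf_esup.
apply: (@le_trans _ _ (ereal_sup ((EFin \o G) @` [set B | Ap B /\
    psdmx (((e / 2)%:C%C)%:M - (nform T B - nform T A0))]))).
  apply: ereal_inf_lbound; eexists; last by reflexivity.
  apply: filterS (near_nform T A0 e2) => B [_ pB] DB.
  by split.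
apply: ge_ereal_sup => _ [B [DB pB] <-]; rewrite lee_fin.
have [_ h] := forms_near_below DB pB.
exact: le_trans h (ltW fe).
Qed.

Lemma forms_admissible : admissible G Ap.
Proof.
split.
- exact: forms_open.
- split; first exact: forms_nonempty.
  by move=> A P DA pP; have [] := eigvals_mono pP DA.
- move=> A P DA pP; rewrite -subr_gt0.
  have sP : semipositive P.
    move=> v; have [->|v0] := eqVneq v 0; last exact/ltW/pP.
    have /is_hermformP[lin _] := hermformP P.
    by have := lin 0 (-1) 0 0; rewrite scaler0 addr0 mulN1r addNr => ->.
  apply: lt_le_trans (eigvals_gain (gamma_cone1 DA) sP).
  rewrite mulr_gt0 // /sigma mpeval_mesym.
  have h (K : {set 'I_n}) : 0 < \prod_(i in K) eigvals rho P 0 i.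
    by apply: prodr_gt0 => i _; exact: (eigvals_pos TG).
  have : (0 < #|[set K : {set 'I_n} | #|K| == d]%SET|)%N.
    by rewrite card_draws card_ord bin_gt0.
  rewrite card_gt0 => /finset.set0Pn; case=> K; rewrite inE => Kd.
  rewrite (bigD1 K) //= ltr_wpDr // sumr_ge0 // => J _; exact: ltW.
- exact: forms_limsup.
Qed.

Lemma forms_QSH : QSH rho Ap.
Proof.
have [b b0 hb] := trace_bound d0 dn cd0 cd.
exists b => // A DA; rewrite /htr /sigma mesym1E /mpeval rmorph_sum.
under eq_bigr do rewrite /= mevalXU.
by apply: hb => J Jd; exact: (gamma_ge0 d0 dn cd cd0 DA Jd).
Qed.

Lemma hdet_le_sigma P : semipositive P ->
  hdet rho P `^ (d%:R / n%:R) <= sigma rho d P / 'C(n, d)%:R.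
Proof.
move=> pP; rewrite /hdet /sigma !mpeval_mesym.
rewrite (big_pred1 [set: 'I_n]%SET) => [|K]; last first.
  apply/eqP/eqP => [cK|->]; last by rewrite cardsT card_ord.
  by apply/eqP; rewrite finset.eqEcard finset.subsetT cardsT card_ord cK leqnn.
under [X in X `^ _]eq_bigl do rewrite inE.
apply: maclaurin; first by rewrite d0.
by move=> i; exact: (eigvals_ge0 TG).
Qed.

End Admissible.

Theorem proposition4p16 (R : realType) (V : vectType R[i])
    (rho : {dot V for Num.conj}) (d : nat) (p : {poly R}) :
  let n := \dim {:V} in
  (1 <= d <= n)%N ->
  size p = d.+1 ->
  0 < p`_d ->
  garding (mpoly_of_poly p) ->
  let f := polarization n p in
  let G := fun A : hermform V => mpeval f (eigvals rho A) in
  let Ap := [set A : hermform V | Gamma d f (eigvals rho A)] in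
  [/\ admissible G Ap,
      QSH rho Ap &
      forall A P : hermform V,
        garding_cone1 f (eigvals rho A) -> semipositive P ->
        p`_d / 'C(n, d)%:R * sigma rho d P <= G (A + P) - G A /\
        p`_d * hdet rho P `^ (d%:R / n%:R) <= p`_d / 'C(n, d)%:R * sigma rho d P].
Proof.
move=> n /andP[d0 dn] szp pd gp f G Ap.
have pn : (size p <= n.+1)%N by rewrite szp.
pose c := pcoef n p.
have cd j : (d < j)%N -> c j = 0.
  by move=> dj; rewrite /c /pcoef nth_default ?mul0r // szp.
have cd0 : 0 < c d by rewrite divr_gt0 // ltr0n bin_gt0.
have nest : forall y0, nested c n d y0 by exact: garding_nested.
have fE x : mpeval f x = pder c finset.set0 x by exact: mpeval_polarization.
have cone1E : garding_cone1 f = cone1 c d.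
  have E i : garding_cone (mderiv i f) = poscone c d [set i]%SET.
    apply: (garding_cone_poscone dn cd cd0 nest); first by rewrite cards1.
    by move=> x; exact: mpeval_mderiv_polarization.
  by apply/seteqP; split=> x Gx i; [rewrite -E|move=> _; rewrite E]; apply: Gx.
have gammaE : Gamma d f = gamma_set c d.
  rewrite /Gamma /gamma_set cone1E; case: ifP => // _.
  by apply: (garding_cone_poscone dn cd cd0 nest); rewrite ?cards0.
have GE : G = fun A => pder c finset.set0 (eigvals rho A).
  by apply: funext => A; exact: fE.
have [T TG] := orthonormal_frame rho.
rewrite /Ap gammaE GE; split.
- exact: (forms_admissible d0 dn cd cd0 nest TG).
- exact: (forms_QSH rho d0 dn cd cd0).
- move=> A P; rewrite cone1E => GA pP; split.
    exact: (eigvals_gain d0 cd TG GA pP).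
  rewrite mulrAC -mulrA ler_wpM2l ?(ltW pd) //.
  exact: (hdet_le_sigma d0 dn TG pP).
Qed.
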